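(* There is an algorithm that solves the sorting buffer problem with buffer size $k=2$ optimally (computing both the optimal cost and an optimal schedule) in time $O(n\log C)$, where $n$ is the number of items and $C$ the number of distinct colors.
   Context: Sorting buffer problem: the input is a sequence $\sigma$ of $n$ items, each item $i$ having a color $c(i)\in\{1,\dots,C\}$, and a buffer capacity $k$. Items are moved one after another, in the order of $\sigma$, into a random-access buffer that can hold at most $k$ items. The buffer has no color initially. At any step a scheduling algorithm chooses a color $c$; then all items in the buffer with color $c$ are removed and processed by a single server; the next items of the sequence are moved into the freed space, and any new items of color $c$ are removed immediately, until no item of color $c$ remains in the buffer. Then a new color is chosen, and so on, until all items are processed. The cost is the number of color changes, to be minimized. The running time is measured relative to the input size, which is $O(n\log C)$ bits. *)

(* Defs.v *)
From mathcomp Require Import all_boot.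

Set Implicit Arguments.
Unset Strict Implicit.
Unset Printing Implicit Defensive.

(* An item is represented by its color, a positive natural number.  A
   configuration is the content of the buffer together with the items that
   have not entered it yet. *)
Definition config := (seq nat * seq nat)%type.

(* Fills a buffer of capacity [k] from the sequence while [c] is the current
   color: an incoming item of color [c] is removed at once, so that it does not
   use up free space.  [buf] is meant to contain no item of color [c]. *)
Fixpoint refill (k c : nat) (buf rest : seq nat) : config :=
  if rest is x :: rest' then
    if size buf < k then
      if x == c then refill k c buf rest' else refill k c (rcons buf x) rest'
    else (buf, rest)
  else (buf, rest).

Definition choose_color (k : nat) (s : config) (c : nat) : config :=
  refill k c [seq x <- s.1 | x != c] s.2.

Definition initial_config (k : nat) (sigma : seq nat) : config :=
  (take k sigma, drop k sigma).

(* A schedule is the sequence of the chosen colors; it is feasible when all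
   items have been processed at the end.  Choosing a color that is absent from
   the buffer is allowed, but has no effect. *)
Definition feasible (k : nat) (sigma schedule : seq nat) : Prop :=
  foldl (choose_color k) (initial_config k sigma) schedule = ([::], [::]).

Fixpoint changes_from (cur : option nat) (schedule : seq nat) : nat :=
  if schedule is c :: schedule' then
    (cur != Some c) + changes_from (Some c) schedule'
  else 0.

(* Initially there is no current color, so the first choice is a change. *)
Definition color_changes (schedule : seq nat) : nat :=
  changes_from None schedule.

Definition optimal_schedule (k : nat) (sigma schedule : seq nat) : Prop :=
  feasible k sigma schedule /\
  forall schedule', feasible k sigma schedule' ->
    color_changes schedule <= color_changes schedule'.

(* The model of computation is the unit-cost word RAM with [w]-bit words:
   registers and memory cells hold integers modulo [2 ^ w], every memory access,
   addition, subtraction and comparison takes one time step.  A program is a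
   finite object that does not depend on [w] and mentions finitely many
   registers.  Control flow is structured. *)
Inductive instr :=
  | Const of nat & nat
  | Add of nat & nat & nat
  | Sub of nat & nat & nat
  | Read of nat & nat
  | Write of nat & nat.

Inductive test :=
  | Lt of nat & nat
  | Eq of nat & nat.

Inductive program :=
  | Skip
  | Do of instr
  | Seq of program & program
  | If of test & program & program
  | While of test & program.

Record state := State { reg : nat -> nat; mem : nat -> nat }.

Definition set_reg (s : state) (r v : nat) : state :=
  State [eta reg s with r |-> v] (mem s).

Definition set_mem (s : state) (a v : nat) : state :=
  State (reg s) [eta mem s with a |-> v].

Definition exec_instr (w : nat) (i : instr) (s : state) : state :=
  match i with
  | Const r v => set_reg s r (v %% 2 ^ w)
  | Add r a b => set_reg s r ((reg s a + reg s b) %% 2 ^ w)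
  | Sub r a b => set_reg s r ((reg s a + (2 ^ w - reg s b)) %% 2 ^ w)
  | Read r a => set_reg s r (mem s (reg s a))
  | Write a r => set_mem s (reg s a) (reg s r)
  end.

Definition eval_test (t : test) (s : state) : bool :=
  match t with
  | Lt a b => reg s a < reg s b
  | Eq a b => reg s a == reg s b
  end.

(* [exec w p s t s']: started in [s], the program [p] halts in [s'] after
   exactly [t] time steps. *)
Inductive exec (w : nat) : program -> state -> nat -> state -> Prop :=
  | ExecSkip s : exec w Skip s 0 s
  | ExecDo i s : exec w (Do i) s 1 (exec_instr w i s)
  | ExecSeq p q s t s' t' s'' :
      exec w p s t s' -> exec w q s' t' s'' ->
      exec w (Seq p q) s (t + t') s''
  | ExecIf b p q s t s' :
      exec w (if eval_test b s then p else q) s t s' ->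
      exec w (If b p q) s t.+1 s'
  | ExecWhileStop b p s :
      ~~ eval_test b s -> exec w (While b p) s 1 s
  | ExecWhileStep b p s t s' t' s'' :
      eval_test b s -> exec w p s t s' -> exec w (While b p) s' t' s'' ->
      exec w (While b p) s (t + t').+1 s''.

(* Input: the number of items in register 0, the number of colors in register
   1 and the colors of the items in the first memory cells; everything else is
   zero. *)
Definition input_state (C : nat) (sigma : seq nat) : state :=
  State (fun r => nth 0 [:: size sigma; C] r) (fun a => nth 0 sigma a).

(* Output: the cost in register 0, and a schedule in the block of memory cells
   whose first address is in register 1 and whose length is in register 2. *)
Definition output_cost (s : state) : nat := reg s 0.

Definition output_schedule (s : state) : seq nat :=
  [seq mem s a | a <- iota (reg s 1) (reg s 2)].

(* [n log C], with the logarithm rounded up; the maxima only matter when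
   [C <= 1] or [n = 0], where this product vanishes. *)
Definition nlogC (n C : nat) : nat := maxn 1 (n * maxn 1 (up_log 2 C)).

(* Main.v *)
Require Import Defs.
From mathcomp Require Import all_boot zify.
(* [all_boot] shadows [mem] and [Sub]. *)
Import Defs.

Set Implicit Arguments.
Unset Strict Implicit.
Unset Printing Implicit Defensive.

(** With [k = 2] the buffer holds back one item while the others pass through in
   order, so a configuration is a held color [u] together with a suffix of the
   sequence.  Let [F u p] be the optimal cost from there and [G p] the optimal
   cost of the suffix [p] alone; then [G p <= F u p <= 1 + G p] for [u] a color,
   and prepending a run to a suffix raises [G] by at most one.  Hence, if neither
   the run at [p] nor the following one has color [u], an optimal schedule either
   releases [u] at once or holds it until the run that precedes the next
   occurrence [j] of [u]:
     [F u p = 1 + min (G p) (K j + r p - r j - 1)],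
   where [r p] counts the runs of the suffix [p] and [K j] depends on [j] only.
   So [F] is read off in constant time from tables indexed by positions, which a
   backward scan fills in linear time; a forward scan then follows a cheapest
   choice at each step.  Colors serve as addresses, so no logarithmic factor is
   needed. *)

(** * Optimal costs and schedules *)

(* Optimal number of further color changes when [c] is the current color, [h] is
   held back and [s] is still to come; 0 stands for no color and no item. *)
Fixpoint opt (c h : nat) (s : seq nat) : nat :=
  if s is v :: s' then
    if v == c then opt c h s'
    else if h == 0 then opt c v s'
    else if v == h then (opt h 0 s').+1
    else (minn (opt h v s') (opt v h s')).+1
  else h != 0.

(* Each of the five inequalities needs some of the others in the induction. *)
Lemma opt_ineqs s : all (ltn 0) s ->
  [/\ forall c h, 0 < h -> h != c -> opt c 0 s <= opt c h s,
      forall c c' h, 0 < h -> h != c -> h != c' ->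
        opt c h s <= (opt c' h s).+1,
      forall c h, 0 < h -> h != c -> opt c h s <= (opt h 0 s).+1,
      forall c c', 0 < c -> c != c' -> opt c 0 s <= (opt c' c s).+1 &
      forall c c' h h', (h == 0) || (h != c) -> (h' == 0) || (h' != c') ->
        opt c h s <= (opt c' h' s).+2].
Proof.
elim: s => [_|v s IH /= /andP[v0 /IH[E G L M Q]]] /=.
  by split=> *; lia.
(* Chains [L] with [E], so that the right-hand state may hold a second item [k]. *)
have L' c h k : 0 < h -> h != c -> k != h -> opt c h s <= (opt h k s).+1.
  move=> h0 hc kh; apply: leq_trans (L _ _ h0 hc) _.
  case: (posnP k) => [-> //|k0]; have := E h k k0 kh; lia.
split.
- move=> c h h0 hc; rewrite (gtn_eqF h0).
  case: eqVneq => [_|vc]; first exact: E.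
  case: eqVneq => [<-|vh]; first exact: L.
  have := G c h v; have := L' c v h; lia.
- move=> c c' h h0 hc hc'; rewrite (gtn_eqF h0).
  case: (eqVneq v c) => [vc|vc]; case: (eqVneq v c') => [vc'|vc'].
  + exact: G.
  + rewrite -vc in hc *; rewrite eq_sym (negbTE hc).
    have := Q v h h v; have := Q v v h h; lia.
  + rewrite -vc' in hc' *; rewrite eq_sym (negbTE hc').
    lia.
  + by case: ifP => _; lia.
- move=> c h h0 hc; rewrite (gtn_eqF h0).
  case: (eqVneq v h) => [vh|vh]; case: (eqVneq v c) => [vc|vc].
  + by rewrite -vh vc eqxx in hc.
  + by [].
  + by rewrite -vc in hc *; apply: L'; rewrite // eq_sym.
  + lia.
- move=> c c' c0 cc'; rewrite (gtn_eqF c0).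
  case: (eqVneq v c) => [vc|vc]; case: (eqVneq v c') => [vc'|vc'].
  + by rewrite -vc vc' eqxx in cc'.
  + lia.
  + by rewrite -vc' in cc' *; apply: L'.
  + have := L' c v c; lia.
- move=> c c' h h' hc hc'.
  case: (eqVneq v c) => [vc|vc].
    case: (eqVneq v c') => [vc'|vc']; first exact: Q.
    case: (eqVneq h' 0) => [h'0|h'0]; first by apply: Q; lia.
    case: (eqVneq v h') => [vh'|vh'].
      by have := Q c h' h 0 hc isT; lia.
    have := Q c h' h v hc; have := Q c v h h' hc; lia.
  case: (eqVneq h 0) => [h0|h0].
    case: (eqVneq v c') => [vc'|vc']; first by apply: Q; lia.
    case: (eqVneq h' 0) => [h'0|h'0]; first by apply: Q; lia.
    case: (eqVneq v h') => [vh'|vh'].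
      have := Q c h' v 0; lia.
    have := Q c h' v v; have := Q c v v h'; lia.
  case: (eqVneq v h) => [vh|vh].
    rewrite -vh in h0 hc *.
    case: (eqVneq v c') => [vc'|vc'].
      case: (eqVneq h' 0) => [->|h'0]; first by rewrite -vc'; lia.
      by have := E v h'; rewrite -vc'; lia.
    case: (eqVneq h' 0) => [h'0|h'0]; first by have := M v c'; lia.
    case: (eqVneq v h') => [<-|vh']; first lia.
    have := Q v h' 0 v; have := Q v v 0 h'; have := E v h'; have := M v h'; lia.
  case: (eqVneq v c') => [vc'|vc'].
    by rewrite -vc' in hc' *; have := L' h v h'; lia.
  case: (eqVneq h' 0) => [h'0|h'0]; first by have := G h c' v; lia.
  case: (eqVneq v h') => [<-|vh']; first by have := L' h v 0; lia.
  have := G h h' v; have := L' h v h'; lia.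
Qed.

(** A current color is no handicap, since its items pass for free. The second claim, that having [x]
    current is at least as good as holding [x], settles the case of the first where nothing is held
    and the next item has color [x]. *)
Lemma opt_current s x : all (ltn 0) s -> 0 < x ->
  (forall h, h != x -> opt x h s <= opt 0 h s) /\ opt x 0 s <= opt 0 x s.
Proof.
move=> + x0; elim: s => [|v s IH] //= /andP[v0 s0].
have [A B] := IH s0; have [E _ L _ _] := opt_ineqs s0.
rewrite (gtn_eqF v0); split.
- move=> h hx; case: (eqVneq v x) => [vx|vx].
    case: (eqVneq h 0) => [->|h0]; first by rewrite vx B // -vx.
    case: (eqVneq v h) => [vh|vh]; first by rewrite -vh vx eqxx in hx.
    have := E h x; have := L x h; rewrite vx; lia.
  case: (eqVneq h 0) => [h0|h0]; first exact: A.
  by case: (eqVneq v h).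
- rewrite (gtn_eqF x0); case: (eqVneq v x) => [//|vx].
  have := L x v; have := E v x; lia.
Qed.

Lemma opt_size c h s : opt c h s <= size s + (h != 0).
Proof.
elim: s c h => [|v s IH] c h //=.
case: eqVneq => _; first by have := IH c h; lia.
case: eqVneq => [_|h0]; first by have := IH c v; lia.
case: eqVneq => _; first by have := IH h 0; lia.
have := IH h v; lia.
Qed.

(** * Configurations as lists and the effect of a choice *)

Fixpoint skip (c : nat) (s : seq nat) : seq nat :=
  if s is x :: s' then if x == c then skip c s' else s else [::].

Lemma skip_pos c s : all (ltn 0) s -> all (ltn 0) (skip c s).
Proof. by elim: s => //= x s IH /andP[x0 s0]; case: ifP => _ /=; rewrite ?x0 ?IH. Qed.

Lemma opt_skip c h s : opt c h s = opt c h (skip c s).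
Proof. by elim: s => //= x s IH; case: ifP => //= ->. Qed.

(** With an item held, the first item of another color fills the buffer and forces a change, so from
    there on the current color can be forgotten. *)
Lemma opt_skip0 c h s : 0 < h -> all (ltn 0) s ->
  opt c h s = opt 0 h (skip c s).
Proof.
move=> h0; elim: s => [|x s IH] //= /andP[x0 s0].
case: ifP => xc; first exact: IH.
by rewrite /= (gtn_eqF x0) (gtn_eqF h0).
Qed.

(* Every reachable configuration is the initial one of the list formed by the
   buffer and the remaining items; this is the effect of a choice on that list. *)
Definition choose_items (c : nat) (l : seq nat) : seq nat :=
  match l with
  | a :: b :: s =>
    if a == c then
      if b == c then
        if skip c s is y :: s' then y :: skip c s' else [::]
      else b :: skip c s
    else if b == c then a :: skip c s else l
  | [:: a] => if a == c then [::] else l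
  | [::] => [::]
  end.

Lemma refill2 c a b s : refill 2 c [:: a; b] s = initial_config 2 (a :: b :: s).
Proof. by rewrite /initial_config /= take0 drop0; case: s. Qed.

Lemma refill1 c h s : refill 2 c [:: h] s = initial_config 2 (h :: skip c s).
Proof.
elim: s => //= x s IH; case: ifP => _ //.
exact: refill2.
Qed.

Lemma refill0 c s : refill 2 c [::] s =
  initial_config 2 (if skip c s is y :: s' then y :: skip c s' else [::]).
Proof.
elim: s => //= x s IH; case: ifP => _ //.
exact: refill1.
Qed.

Lemma choose_color_items c l :
  choose_color 2 (initial_config 2 l) c = initial_config 2 (choose_items c l).
Proof.
rewrite /choose_color; case: l => [|a [|b s]] //=.
  by case: eqVneq.
rewrite take0 drop0; case: (eqVneq a c) => _; case: (eqVneq b c) => _ //=.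
- exact: refill0.
- exact: refill1.
- exact: refill1.
- exact: refill2.
Qed.

Lemma choose_items_pos c l : all (ltn 0) l -> all (ltn 0) (choose_items c l).
Proof.
case: l => [|a [|b s]] //=; first by case: ifP.
case/and3P=> a0 b0 s0; have := skip_pos c s0.
case: ifP => _; case: ifP => _ //=; rewrite ?a0 ?b0 ?s0 //.
by case: (skip c s) => //= y s' /andP[-> /(skip_pos c)].
Qed.

Lemma skip_head c s y s' : skip c s = y :: s' -> (y == c) = false.
Proof. by elim: s => //= x s IH; case: ifP => // xc [<-]. Qed.

(** [changes_from] does not charge for repeating a color; the lower bound therefore relies on a
    repetition having no effect. *)
Lemma choose_itemsK c l : choose_items c (choose_items c l) = choose_items c l.
Proof.
have hold a s : (a == c) = false ->
    choose_items c (a :: skip c s) = a :: skip c s.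
  move=> ac; case F: (skip c s) => [|z s''] /=; rewrite ac //.
  by rewrite (skip_head F).
case: l => [|a [|b s]] //; first by rewrite /=; case: ifP => //= ->.
rewrite {2 3}/choose_items; case: ifP => ac; case: ifP => bc; try exact: hold.
  by case E: (skip c s) => [|y s'] //; apply: hold (skip_head E).
by rewrite /= ac bc.
Qed.

(** Bellman equation for a full buffer of two colors; [opt_double] is its counterpart for a single
    color. *)
Lemma opt_pair a b s : 0 < a -> 0 < b -> all (ltn 0) s -> a != b ->
  opt 0 0 (a :: b :: s) =
  (minn (opt 0 0 (choose_items a (a :: b :: s)))
        (opt 0 0 (choose_items b (a :: b :: s)))).+1.
Proof.
move=> a0 b0 s0 ab /=; rewrite !eqxx [b == a]eq_sym (negbTE ab).
rewrite /= !(gtn_eqF a0) (gtn_eqF b0).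
by rewrite !(opt_skip0 _ _ s0).
Qed.

Lemma opt_double a s : 0 < a -> all (ltn 0) s ->
  opt 0 0 (a :: a :: s) = (opt 0 0 (choose_items a (a :: a :: s))).+1.
Proof.
move=> a0 s0 /=; rewrite !eqxx (gtn_eqF a0) (opt_skip a 0 s).
have := skip_pos a s0.
case E: (skip a s) => [|y s'] //= /andP[y0 s0'].
by rewrite (skip_head E) (gtn_eqF y0) opt_skip0.
Qed.

(** * Lower bound for all schedules *)

Lemma opt_choose c l : all (ltn 0) l ->
  opt 0 0 l <= (opt 0 0 (choose_items c l)).+1.
Proof.
case: l => [|a [|b s]] // l0.
  by apply: leq_trans (opt_size _ _ _) _.
have /and3P[a0 b0 s0] := l0.
case: (eqVneq a b) => [eab|nab].
  rewrite -eab; case: (eqVneq a c) => [<-|ac]; first by rewrite opt_double.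
  by rewrite /choose_items (negbTE ac).
case: (eqVneq a c) => [<-|ac]; first by rewrite opt_pair //; lia.
case: (eqVneq b c) => [<-|bc]; first by rewrite opt_pair //; lia.
by rewrite /choose_items (negbTE ac) (negbTE bc).
Qed.

(** Induction on the schedule: a charged choice lowers [opt] by at most one, and an uncharged one
    repeats [cur], which by the second hypothesis leaves the configuration alone. *)
Lemma opt_lower_bound sched cur l : all (ltn 0) l ->
  (forall c, cur = Some c -> choose_items c l = l) ->
  foldl (choose_color 2) (initial_config 2 l) sched = ([::], [::]) ->
  opt 0 0 l <= changes_from cur sched.
Proof.
elim: sched cur l => [|c sched IH] cur l l0 curl.
  by case: l {l0 curl}.
rewrite [foldl _ _ _]/= choose_color_items /= => fin.
have H : opt 0 0 (choose_items c l) <= changes_from (Some c) sched.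
  apply: IH fin; first exact: choose_items_pos.
  by move=> _ [<-]; exact: choose_itemsK.
case: eqVneq => [/curl <- //|_].
have := opt_choose c l0; lia.
Qed.

(** The chain [size sched <= opt <= color_changes sched <= size sched] collapses, so a short enough
    feasible schedule certifies its own optimality. *)
Lemma optimal_of_size sigma sched : all (ltn 0) sigma ->
  feasible 2 sigma sched -> size sched <= opt 0 0 sigma ->
  optimal_schedule 2 sigma sched /\ size sched = color_changes sched.
Proof.
move=> s0 fs szs.
have low s' : feasible 2 sigma s' -> opt 0 0 sigma <= color_changes s'.
  by move=> fs'; apply: opt_lower_bound fs' => // c.
have up cur s' : changes_from cur s' <= size s'.
  by elim: s' cur => //= c s' IH cur; have := IH (Some c); case: (_ != _); lia.
have := low _ fs; have : color_changes sched <= size sched by exact: up.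
split; last by lia.
by split=> // s' /low; lia.
Qed.

(** * Costs in terms of positions *)

(** The new run can be processed first; afterwards its color is current, which by [opt_current] is
    no worse than starting afresh. *)
Lemma opt_run x s : 0 < x -> all (ltn 0) s ->
  opt 0 0 (x :: s) <= (opt 0 0 (skip x s)).+1.
Proof.
move=> x0; case: s => [|y s] /=; first by rewrite (gtn_eqF x0).
case/andP=> y0 s0; rewrite !(gtn_eqF x0) (gtn_eqF y0).
case: (eqVneq y x) => [_|yx] /=.
  by rewrite opt_skip ltnS; apply: (opt_current (skip_pos x s0) x0).1; rewrite neq_ltn x0.
rewrite (gtn_eqF y0) ltnS; have := (opt_current s0 x0).1 y yx; lia.
Qed.

(** Counts the last items of runs. The default 0 of [head] is no color, so the final run of a list
    of colors is counted too. *)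
Fixpoint runs (s : seq nat) : nat :=
  if s is x :: s' then (x != head 0 s') + runs s' else 0.

Lemma runs_size s : runs s <= size s.
Proof. by elim: s => //= x s; case: (_ != _); lia. Qed.

Lemma opt_gt0 c h s : 0 < h -> 0 < opt c h s.
Proof.
move=> h0; elim: s => [|v s IH] /=; first by rewrite -lt0n h0.
rewrite (gtn_eqF h0); by repeat case: ifP.
Qed.

Section Tables.

Variable sigma : seq nat.
Hypothesis sigma_pos : all (ltn 0) sigma.

Local Notation n := (size sigma).
Local Notation col := (nth 0 sigma).

(** * Positions of runs and of next occurrences *)

Definition run_end (p : nat) : nat := p + find (predC1 (col p)) (drop p sigma).
(** The value is [n] if the color of an item does not occur again, and [n.+1] at the sentinel
    position [n]. *)
Definition next_item (p : nat) : nat := p.+1 + index (col p) (drop p.+1 sigma).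
Definition run_count (p : nat) : nat := runs (drop p sigma).
Definition skip_item (c p : nat) : nat := if col p == c then run_end p else p.

(* Optimal cost when the held item has color [c] and item [p] comes next. *)
Definition cost (c p : nat) : nat := opt 0 c (drop p sigma).

Lemma col_gt0 p : p < n -> 0 < col p.
Proof. by move=> pn; apply: (allP sigma_pos); rewrite mem_nth. Qed.

Lemma drop_pos p : all (ltn 0) (drop p sigma).
Proof. by move: sigma_pos; rewrite -{1}(cat_take_drop p sigma) all_cat => /andP[]. Qed.

Lemma run_endS p : p < n ->
  run_end p = if col p.+1 == col p then run_end p.+1 else p.+1.
Proof.
move=> pn; rewrite /run_end (drop_nth 0 pn) /= eqxx /= addnS -addSn.
case: eqVneq => [->//|ne].
case: (ltnP p.+1 n) => pn1; last by rewrite drop_oversize ?addn0.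
by rewrite (drop_nth 0 pn1) /= ne addn0.
Qed.

Lemma run_end_id p : n <= p -> run_end p = p.
Proof. by move=> np; rewrite /run_end drop_oversize // addn0. Qed.

Lemma run_end_bounds p : p < n -> p < run_end p <= n.
Proof.
have [m] := ubnP (n - p); elim: m p => // m IH p pm pn.
rewrite run_endS //; case: eqP => e; last by lia.
case: (ltnP p.+1 n) => pn1; last by rewrite run_end_id; lia.
have := IH p.+1; lia.
Qed.

Lemma col_in_run p q : p <= q < run_end p -> col q = col p.
Proof.
have [m] := ubnP (n - p); elim: m p => // m IH p pm.
case: (ltnP p n) => pn; last by rewrite run_end_id; lia.
rewrite run_endS //; case: eqP => e pq; last by have -> : q = p by lia.
case: (ltngtP p q) pq => [lpq|?|->] // pq.
by rewrite -e; apply: IH; lia.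
Qed.

Lemma col_run_end p : p < n -> col (run_end p) != col p.
Proof.
have [m] := ubnP (n - p); elim: m p => // m IH p pm pn.
rewrite run_endS //; case: (eqVneq (col p.+1) (col p)) => e //.
case: (ltnP p.+1 n) => pn1; first by rewrite -e; apply: IH; lia.
(* Past the last item the default color 0 is read, which no item has. *)
by have := col_gt0 pn; rewrite -e nth_default.
Qed.

Lemma skip_itemE c p : 0 < c -> skip c (drop p sigma) = drop (skip_item c p) sigma.
Proof.
move=> c0; have [m] := ubnP (n - p); elim: m p => // m IH p pm.
case: (ltnP p n) => pn; last first.
  rewrite drop_oversize //= /skip_item run_end_id //.
  by rewrite if_same drop_oversize.
rewrite (drop_nth 0 pn) /= /skip_item; case: eqP => [e|ne]; last by rewrite -drop_nth.
rewrite IH; last by lia.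
by rewrite run_endS // /skip_item e; case: eqP.
Qed.

Lemma run_endE p : p < n -> run_end p = skip_item (col p) p.+1.
Proof. exact: run_endS. Qed.

Lemma run_count_le p : run_count p <= n.
Proof. by apply: leq_trans (runs_size _) _; rewrite size_drop leq_subr. Qed.

Lemma run_countS p : p < n -> run_count p = (col p.+1 != col p) + run_count p.+1.
Proof.
move=> pn; rewrite /run_count (drop_nth 0 pn) /= eq_sym.
by rewrite -nth0 nth_drop addn0.
Qed.

Lemma run_count_end p : p < n -> run_count p = (run_count (run_end p)).+1.
Proof.
have [m] := ubnP (n - p); elim: m p => // m IH p pm pn.
rewrite run_countS // run_endS //; case: (eqVneq (col p.+1) (col p)) => e //=.
case: (ltnP p.+1 n) => pn1; first by apply: IH; lia.
by have := col_gt0 pn; rewrite -e nth_default.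
Qed.

Lemma next_item_gt p : p < next_item p.
Proof. exact: leq_addr. Qed.

Lemma next_item_id p : n <= p -> next_item p = p.+1.
Proof. by move=> np; rewrite /next_item drop_oversize ?addn0 //; lia. Qed.

Lemma next_item_le p : p < n -> next_item p <= n.
Proof.
by move=> pn; rewrite /next_item -[leqRHS](subnKC pn) leq_add2l -size_drop index_size.
Qed.

Lemma col_next p : p < n -> next_item p < n -> col (next_item p) = col p.
Proof.
move=> pn; rewrite /next_item => jn; rewrite -nth_drop nth_index //.
by rewrite -index_mem size_drop ltn_subRL.
Qed.

Lemma col_before_next p q : p < q < next_item p -> col q != col p.
Proof.
move=> pq; have -> : q = p.+1 + (q - p.+1) by lia.
rewrite -nth_drop; apply/negP => /eqP e.
have : q - p.+1 < index (col p) (drop p.+1 sigma).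
  by case/andP: pq => pq qj; rewrite ltn_subLR.
by move/(before_find 0); rewrite /= e eqxx.
Qed.

Lemma skip_item_ge c p : p <= skip_item c p.
Proof. by rewrite /skip_item /run_end; case: ifP => _ //; exact: leq_addr. Qed.

(** * Recurrences for the cost *)

(** Releasing the held item lets the run at [p] pass; the item after the run becomes the held one,
    and items of the released color right behind it pass as well. *)
Lemma cost_same p : p < n ->
  cost (col p) p = (cost (col (run_end p)) (skip_item (col p) (run_end p).+1)).+1.
Proof.
move=> pn; have c0 := col_gt0 pn; rewrite /cost {1}(drop_nth 0 pn) /=.
rewrite (gtn_eqF c0) eqxx opt_skip skip_itemE // -run_endE //.
case: (ltnP (run_end p) n) => en; last first.
  (* At the end of the sequence the new held color is the default 0, that is, nothing is held. *)
  rewrite [col (run_end p)]nth_default // !drop_oversize //.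
  by apply: leq_trans (skip_item_ge _ _); exact: leqW.
rewrite (drop_nth 0 en) /= (negbTE (col_run_end pn)).
by rewrite opt_skip0 ?drop_pos ?col_gt0 // skip_itemE.
Qed.

(** The two terms are the two choices: release [c] and hold item [p], or let the run at [p] pass and
    keep [c]. *)
Lemma cost_diff c p : p < n -> 0 < c -> c != col p ->
  cost c p = (minn (cost (col p) (skip_item c p.+1)) (cost c (run_end p))).+1.
Proof.
move=> pn c0 cp; have p0 := col_gt0 pn; rewrite /cost {1}(drop_nth 0 pn) /=.
rewrite (gtn_eqF p0) (gtn_eqF c0) eq_sym (negbTE cp).
by rewrite (opt_skip0 (col p) c0 (drop_pos _)) (opt_skip0 c p0 (drop_pos _))
           !skip_itemE // -run_endE // minnC.
Qed.

Lemma cost0 p : p < n -> cost 0 p = cost (col p) p.+1.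
Proof. by move=> pn; rewrite /cost (drop_nth 0 pn) /= (gtn_eqF (col_gt0 pn)). Qed.

Lemma cost_nil c p : n <= p -> cost c p = (c != 0).
Proof. by move=> np; rewrite /cost drop_oversize. Qed.

Lemma cost_le c p : cost c p <= n.+1.
Proof.
apply: leq_trans (opt_size _ _ _) _; rewrite size_drop.
by case: (_ != _); lia.
Qed.

Lemma cost_gt0 c p : 0 < c -> 0 < cost c p.
Proof. by move=> c0; apply: opt_gt0; rewrite ?drop_pos. Qed.

Lemma cost0_run p : p < n -> cost 0 p <= (cost 0 (run_end p)).+1.
Proof.
move=> pn; rewrite /cost (drop_nth 0 pn).
apply: leq_trans (opt_run (col_gt0 pn) (drop_pos _)) _.
by rewrite skip_itemE ?col_gt0 // -run_endE.
Qed.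

(** After the release of [c] the rest is a start at [p], with [c] as current color instead of none,
    and this can only help. *)
Lemma cost_release c p : p < n -> 0 < c -> c != col p ->
  cost (col p) (skip_item c p.+1) <= cost 0 p.
Proof.
move=> pn c0 cp; rewrite cost0 // /cost -skip_itemE //.
rewrite -opt_skip0 ?drop_pos ?col_gt0 //.
by apply: (opt_current (drop_pos _) c0).1; rewrite eq_sym.
Qed.

(* Position [size sigma] counts as an occurrence of every color. *)
Definition match_cost (p : nat) : nat := if p == n then 1 else cost (col p) p.

(* One less than the cost of holding an item of color [col (run_end p)] when the
   run of item [p] comes next. *)
Definition meet_cost (p : nat) : nat :=
  minn (match_cost (run_end p)) (cost (col p) (skip_item (col (run_end p)) p.+1)).

(* The held item [h] and the next position [p] for which the tables give the cost. *)
Definition query_ok (h p : nat) : bool :=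
  (next_item h == p) || [&& h < p, p < next_item h & col p.-1 != col p].

Lemma match_cost_next h : h <= n -> cost (col h) (next_item h) = match_cost (next_item h).
Proof.
move=> hn; rewrite /match_cost; case: (ltnP (next_item h) n) => jn.
  have h' := leq_trans (next_item_gt h) (ltnW jn).
  by rewrite (ltn_eqF jn) col_next.
rewrite !cost_nil //; case: (ltnP h n) => h'.
  have en : next_item h = n by have := next_item_le h'; lia.
  by rewrite en eqxx (gtn_eqF (col_gt0 h')).
(* Here [h] is the sentinel: nothing is held and both sides are 0. *)
have -> : h = n by lia.
rewrite next_item_id // (gtn_eqF (ltnSn n)).
by rewrite !nth_default.
Qed.

(** * Holding an item until its next occurrence *)

(** If the next occurrence lay inside the run of [p], then [p] would have the color of [h] and be an
    earlier occurrence. *)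
Lemma next_item_run h p : h < p -> p < next_item h -> run_end p <= next_item h.
Proof.
move=> hp pj; case: (leqP (run_end p) (next_item h)) => // ej.
case: (ltnP h n) => hn; last by rewrite next_item_id in pj; lia.
have pn := leq_trans pj (next_item_le hn).
have e : col (next_item h) = col p by apply: col_in_run; lia.
have := run_end_bounds pn => ?.
have := col_before_next (p := h) (q := p); rewrite hp pj => /(_ isT).
by rewrite -e col_next ?eqxx //; lia.
Qed.

(** Induction along the runs between [p] and the next occurrence of the color of [h]; the witness
    [b] is the start of the last of them. Only there can a delayed release beat an immediate one,
    because items of the held color may follow at once. *)
Lemma cost_hold h p : h < p -> p < next_item h -> col p.-1 != col p ->
  exists b, [/\ p <= b < n, col b.-1 != col b, run_end b = next_item h,
    run_count (next_item h) < run_count p &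
    cost (col h) p = (minn (cost 0 p)
       (meet_cost b + run_count p - (run_count (next_item h)).+1)).+1].
Proof.
have [m] := ubnP (n - p); elim: m p => // m IH p pm hp pj start.
case: (ltnP h n) => hn; last by rewrite next_item_id in pj; lia.
have jn := next_item_le hn; have pn := leq_trans pj jn.
have ej := next_item_run hp pj; have ebd := run_end_bounds pn.
have h0 := col_gt0 hn; have hcp : col h != col p.
  by rewrite eq_sym; apply: col_before_next; lia.
have rel := cost_release pn h0 hcp.
have rc := run_count_end pn.
case: (ltngtP (run_end p) (next_item h)) ej => // [ej|ej] _.
  have start' : col (run_end p).-1 != col (run_end p).
    rewrite (col_in_run (p := p)); last by lia.
    by rewrite eq_sym col_run_end.
  have [||b [pb sb eb rcb cb]] := IH (run_end p) _ _ ej start'; try lia.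
  exists b; split=> //; try lia.
  rewrite cost_diff // cb.
  have nxt : skip_item (col h) p.+1 = p.+1.
    rewrite /skip_item; case: eqVneq => // e.
    by have := col_before_next (p := h) (q := p.+1); rewrite e eqxx; lia.
  (* An immediate release leaves exactly [cost 0 p]. Releasing one run later does not improve on it,
     as [cost 0] grows by at most one per run. *)
  rewrite nxt -cost0 //; have := cost0_run pn; lia.
exists p; split=> //; [lia | by rewrite -ej rc | ].
rewrite /meet_cost (cost_diff pn h0 hcp) -ej.
have -> : match_cost (run_end p) = cost (col h) (run_end p).
  by rewrite ej match_cost_next // ltnW.
case: (ltnP (run_end p) n) => en.
  have -> : col (run_end p) = col h by rewrite ej col_next // -ej.
  lia.
(* Without a further occurrence [meet_cost] reads the default color 0 instead of the held one. Both
   minima are nevertheless 1, the value of [match_cost] at [n], as costs with a held item are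
   positive. *)
have en' : run_end p = n by lia.
rewrite en' (nth_default 0 (leqnn n)) (cost_nil _ (leqnn n)) (gtn_eqF h0) /=.
have cp0 := cost_gt0 _ (col_gt0 pn).
have := cost0 pn; have := cp0 p.+1; have := cp0 (skip_item (col h) p.+1).
have := cp0 (skip_item 0 p.+1).
rewrite rc en'; lia.
Qed.

(** * Pairs covered by the tables *)

(** This lemma and the next two cover the pairs that the algorithm looks up: a fresh start, the
    state after a release, and the state after a run has passed. *)
Lemma query_next p : p <= n -> query_ok p p.+1.
Proof.
move=> pn; rewrite /query_ok ltnSn /= eq_sym; case: eqVneq => // ne; apply/orP; right.
have := next_item_gt p => ?; apply/andP; split; first by lia.
case: (ltnP p n) => pn'; last by rewrite next_item_id ?eqxx in ne.
by rewrite eq_sym; apply: col_before_next; lia.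
Qed.

Lemma query_skip c p : p <= n -> c != col p -> query_ok p (skip_item c p.+1).
Proof.
move=> pn cp; rewrite /skip_item; case: eqVneq => [e|_]; last exact: query_next.
case: (ltnP p.+1 n) => pn1; last by rewrite run_end_id //; exact: query_next.
have bd := run_end_bounds pn1.
have pj : p.+1 < next_item p.
  have := next_item_gt p => ?; case: (ltngtP p.+1 (next_item p)) => // [|e']; first lia.
  by rewrite e' col_next ?eqxx in e cp => //; lia.
have ej := next_item_run (ltnSn p) pj.
rewrite /query_ok; case: eqVneq => // ne; apply/orP; right.
have {}ne : run_end p.+1 < next_item p by rewrite ltn_neqAle eq_sym ne.
apply/and3P; split; [lia | exact: ne | ].
rewrite (col_in_run (p := p.+1)); last by lia.
by rewrite eq_sym col_run_end.
Qed.

Lemma query_run_end h p : query_ok h p -> p < n -> col h != col p ->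
  query_ok h (run_end p).
Proof.
move=> hp pn ne; have bd := run_end_bounds pn.
have [hj pj] : h < p /\ p < next_item h.
  case/orP: hp => [/eqP e|/and3P[]//].
  have hn : h < n by have := next_item_gt h; lia.
  by rewrite -e col_next ?eqxx // e in ne.
have ej := next_item_run hj pj.
rewrite /query_ok; case: eqVneq => // ne'; apply/orP; right.
have {}ne' : run_end p < next_item h by rewrite ltn_neqAle eq_sym ne'.
apply/and3P; split; [lia | exact: ne' | ].
rewrite (col_in_run (p := p)); last by lia.
by rewrite eq_sym col_run_end.
Qed.

End Tables.

(** * Structured commands on arrays *)

Record store := Store { var : nat -> nat; arr : nat -> nat -> nat }.

Definition set_var (s : store) (x v : nat) : store :=
  Store [eta var s with x |-> v] (arr s).

Definition set_arr (s : store) (k p v : nat) : store :=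
  Store (var s) [eta arr s with k |-> ([eta arr s k with p |-> v] : nat -> nat)].

Inductive expr :=
  | Var of nat
  | Num of nat
  | Plus of expr & expr
  | Minus of expr & expr
  | Get of nat & expr.

Inductive cond :=
  | Less of expr & expr
  | Same of expr & expr.

Inductive cmd :=
  | Assign of nat & expr
  | Put of nat & expr & expr
  | Then of cmd & cmd
  | Cond of cond & cmd & cmd
  | Loop of cond & cmd.

Fixpoint eval (s : store) (e : expr) : nat :=
  match e with
  | Var x => var s x
  | Num c => c
  | Plus a b => eval s a + eval s b
  | Minus a b => eval s a - eval s b
  | Get k i => arr s k (eval s i)
  end.

Definition holds (s : store) (b : cond) : bool :=
  match b with
  | Less a b => eval s a < eval s b
  | Same a b => eval s a == eval s b
  end.

(* Variables live in registers 0-15, the address of array [k] in register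
   [16 + k], intermediate results in registers 32 and above. *)
Fixpoint expr_ok (e : expr) : bool :=
  match e with
  | Var x => x < 16
  | Num c => c < 4
  | Plus a b | Minus a b => expr_ok a && expr_ok b
  | Get k i => (k < 9) && expr_ok i
  end.

Definition cond_ok (b : cond) : bool :=
  match b with Less a b | Same a b => expr_ok a && expr_ok b end.

Fixpoint cmd_ok (c : cmd) : bool :=
  match c with
  | Assign x e => (x < 16) && expr_ok e
  | Put k i e => [&& k < 9, expr_ok i & expr_ok e]
  | Then a b => cmd_ok a && cmd_ok b
  | Cond b c d => [&& cond_ok b, cmd_ok c & cmd_ok d]
  | Loop b c => cond_ok b && cmd_ok c
  end.

(** Stack discipline: the value goes to register [d] and only registers from [d] on change. A
    register is copied by adding zero to it. *)
Fixpoint compile_expr (d : nat) (e : expr) : program :=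
  match e with
  | Var x => Seq (Do (Const d.+1 0)) (Do (Add d x d.+1))
  | Num c => Do (Const d c)
  | Plus a b => Seq (Seq (compile_expr d a) (compile_expr d.+1 b)) (Do (Add d d d.+1))
  | Minus a b => Seq (Seq (compile_expr d a) (compile_expr d.+1 b)) (Do (Sub d d d.+1))
  | Get k i => Seq (Seq (compile_expr d i) (Do (Add d d (16 + k)))) (Do (Read d d))
  end.

Fixpoint expr_time (e : expr) : nat :=
  match e with
  | Var _ => 2
  | Num _ => 1
  | Plus a b | Minus a b => expr_time a + expr_time b + 1
  | Get _ i => expr_time i + 1 + 1
  end.

Definition compile_cond (b : cond) : program :=
  match b with
  | Less a b | Same a b => Seq (compile_expr 32 a) (compile_expr 33 b)
  end.

Definition cond_test (b : cond) : test :=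
  match b with Less _ _ => Lt 32 33 | Same _ _ => Eq 32 33 end.

Definition cond_time (b : cond) : nat :=
  match b with Less a b | Same a b => expr_time a + expr_time b end.

Fixpoint compile (c : cmd) : program :=
  match c with
  | Assign x e =>
    Seq (compile_expr 32 e) (Seq (Do (Const 33 0)) (Do (Add x 32 33)))
  | Put k i e =>
    Seq (Seq (compile_expr 32 i) (Do (Add 32 32 (16 + k))))
        (Seq (compile_expr 33 e) (Do (Write 32 33)))
  | Then a b => Seq (compile a) (compile b)
  | Cond b c d => Seq (compile_cond b) (If (cond_test b) (compile c) (compile d))
  | Loop b c =>
    Seq (compile_cond b) (While (cond_test b) (Seq (compile c) (compile_cond b)))
  end.

(** Meant for loop-free commands; loops get their bound from [yields_loop]. *)
Fixpoint cmd_time (c : cmd) : nat :=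
  match c with
  | Assign _ e => expr_time e + 2
  | Put _ i e => expr_time i + 1 + (expr_time e + 1)
  | Then a b => cmd_time a + cmd_time b
  | Cond b c d => cond_time b + (maxn (cmd_time c) (cmd_time d)).+1
  | Loop b c => 0
  end.

(** * Simulation of commands by the machine *)

Section Compilation.

Variables (w n C : nat).
Hypothesis room : 8 * n.+2 + C.+1 < 2 ^ w.

(** Position arrays have cells up to the sentinel [n.+1]. The array indexed by colors comes last, so
    that base addresses are multiples of [n.+2]. *)
Definition arr_size (k : nat) : nat := if k < 8 then n.+2 else C.+1.

Definition represents (s : store) (r : state) : Prop :=
  [/\ forall x, x < 16 -> reg r x = var s x,
      forall k, k < 9 -> reg r (16 + k) = k * n.+2,
      forall k p, k < 9 -> p < arr_size k -> mem r (k * n.+2 + p) = arr s k p,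
      forall x, x < 16 -> var s x < 2 ^ w &
      forall k p, k < 9 -> p < arr_size k -> arr s k p < 2 ^ w].

(** Conditions under which arithmetic modulo [2 ^ w] agrees with that on natural numbers and reads
    stay inside their array. *)
Fixpoint safe (s : store) (e : expr) : Prop :=
  match e with
  | Var _ | Num _ => True
  | Plus a b => [/\ safe s a, safe s b & eval s a + eval s b < 2 ^ w]
  | Minus a b => [/\ safe s a, safe s b & eval s b <= eval s a]
  | Get k i => safe s i /\ eval s i < arr_size k
  end.

Definition cond_safe (s : store) (b : cond) : Prop :=
  match b with Less a b | Same a b => safe s a /\ safe s b end.

Lemma address_lt k p : k < 9 -> p < arr_size k -> k * n.+2 + p < 2 ^ w.
Proof.
rewrite /arr_size; case: (ltnP k 8) => [k8 _ p0|k8 k9 p0]; last by have -> : k = 8; lia.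
have : k * n.+2 <= 7 * n.+2 by rewrite leq_mul2r; lia.
lia.
Qed.

Lemma address_inj k k' p p' : k < 9 -> p < arr_size k -> k' < 9 -> p' < arr_size k' ->
  k * n.+2 + p = k' * n.+2 + p' -> k = k' /\ p = p'.
Proof.
rewrite /arr_size => k9 pk k9' pk' e.
suff ek : k = k' by split=> //; move: e; rewrite ek; lia.
(* All blocks but the last have size [n.+2], so a block of smaller index lies entirely below. *)
have aux j q j' q' : j < j' -> q < (if j < 8 then n.+2 else C.+1) -> j' < 9 ->
    j * n.+2 + q < j' * n.+2 + q'.
  move=> lj; have -> : j < 8 = (j' < 9) || (j < 8) by lia.
  move=> + j9; rewrite j9 /= => lq.
  have : j.+1 * n.+2 <= j' * n.+2 by rewrite leq_mul2r lj orbT.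
  by rewrite mulSn; lia.
case: (ltngtP k k') => // lk.
- by have := aux _ _ _ p' lk pk k9'; rewrite e ltnn.
- by have := aux _ _ _ p lk pk' k9; rewrite e ltnn.
Qed.

Lemma eval_lt s r e : represents s r -> expr_ok e -> safe s e -> eval s e < 2 ^ w.
Proof.
case=> _ _ _ rv ra; elim: e => /=.
- by move=> x /rv.
- by move=> c c4 _; apply: leq_trans room; lia.
- by move=> a IHa b IHb _ [].
- by move=> a IHa b IHb /andP[/IHa {}IHa _] [/IHa {}IHa _ _]; lia.
- by move=> k i _ /andP[k9 _] [_]; exact: ra.
Qed.

Lemma represents_ext s r r' : represents s r ->
  (forall x, x < 32 -> reg r' x = reg r x) -> mem r' = mem r -> represents s r'.
Proof.
move=> [rx rb rm rv ra] er em; split=> //.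
- by move=> x x16; rewrite er ?rx; lia.
- by move=> k k9; rewrite er ?rb; lia.
- by move=> k p k9 pk; rewrite em rm.
Qed.

Lemma compile_exprP s r e d : represents s r -> expr_ok e -> safe s e -> 32 <= d ->
  exists r', [/\ exec w (compile_expr d e) r (expr_time e) r', reg r' d = eval s e,
    forall x, x < d -> reg r' x = reg r x & mem r' = mem r].
Proof.
elim: e d r => [x|c|a IHa b IHb|a IHa b IHb|k i IHi] d r rs /=.
- move=> x16 _ d32; eexists; split.
  + by apply: (ExecSeq (t := 1) (t' := 1)); exact: ExecDo.
  + case: rs => rx _ _ rv _ /=; rewrite !eqxx mod0n addn0.
    have -> : (x == d.+1) = false by lia.
    by rewrite rx // modn_small ?rv.
  + by move=> y yd /=; rewrite !ifN //; lia.
  + by [].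
- move=> c4 _ d32; eexists; split; first exact: ExecDo.
  + by rewrite /= eqxx modn_small //; apply: leq_trans room; lia.
  + by move=> y yd /=; rewrite ifN //; lia.
  + by [].
- move=> /andP[oa ob] [sa sb sab] d32.
  have [ra [ea va xa ma]] := IHa d r rs oa sa d32.
  have rsa : represents s ra by apply: represents_ext rs _ ma => x x32; apply: xa; lia.
  have [rb [eb vb xb mb]] := IHb d.+1 ra rsa ob sb (leqW d32).
  eexists; split.
  + by apply: ExecSeq; [apply: ExecSeq; eassumption | exact: ExecDo].
  + by rewrite /= eqxx vb xb // va modn_small.
  + by move=> y yd /=; rewrite ifN ?xb ?xa //; lia.
  + by rewrite /= mb.
- move=> /andP[oa ob] [sa sb sab] d32.
  have [ra [ea va xa ma]] := IHa d r rs oa sa d32.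
  have rsa : represents s ra by apply: represents_ext rs _ ma => x x32; apply: xa; lia.
  have [rb [eb vb xb mb]] := IHb d.+1 ra rsa ob sb (leqW d32).
  have la := eval_lt rs oa sa; have lb := eval_lt rs ob sb.
  eexists; split.
  + by apply: ExecSeq; [apply: ExecSeq; eassumption | exact: ExecDo].
  + rewrite /= eqxx vb xb // va.
    have -> : eval s a + (2 ^ w - eval s b) = eval s a - eval s b + 2 ^ w by lia.
    by rewrite modnDr modn_small //; lia.
  + by move=> y yd /=; rewrite ifN ?xb ?xa //; lia.
  + by rewrite /= mb.
- move=> /andP[k9 oi] [si ik] d32.
  have [ri [ei vi xi mi]] := IHi d r rs oi si d32.
  have rsi : represents s ri by apply: represents_ext rs _ mi => x x32; apply: xi; lia.
  have [_ rb rm _ _] := rsi.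
  eexists; split.
  + by apply: ExecSeq; [apply: ExecSeq; [eassumption | exact: ExecDo] | exact: ExecDo].
  + rewrite /= !eqxx vi rb // modn_small addnC ?address_lt //.
    exact: rm.
  + by move=> y yd /=; rewrite ifN ?ifN ?xi //; lia.
  + by rewrite /= mi.
Qed.

Lemma compile_condP s r b : represents s r -> cond_ok b -> cond_safe s b ->
  exists r', [/\ exec w (compile_cond b) r (cond_time b) r', represents s r' &
    eval_test (cond_test b) r' = holds s b].
Proof.
have aux a a' : represents s r -> expr_ok a && expr_ok a' -> safe s a /\ safe s a' ->
    exists r', [/\ exec w (Seq (compile_expr 32 a) (compile_expr 33 a')) r
        (expr_time a + expr_time a') r', represents s r',
      reg r' 32 = eval s a & reg r' 33 = eval s a'].
  move=> rs /andP[oa ob] [sa sb].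
  have [ra [ea va xa ma]] := compile_exprP rs oa sa (leqnn 32).
  have rsa : represents s ra by apply: represents_ext rs _ ma.
  have [rb [eb vb xb mb]] := compile_exprP rsa ob sb (ltnW (leqnn 33)).
  exists rb; split=> //; [exact: ExecSeq ea eb | | by rewrite xb].
  by apply: represents_ext rsa _ mb => x x32; apply: xb; lia.
move=> rs; case: b => a a' ok sf; have [r' [? ? va vb]] := aux a a' rs ok sf;
  by exists r'; split=> //=; rewrite va vb.
Qed.

Lemma represents_set_var s r x v : represents s r -> x < 16 -> v < 2 ^ w ->
  represents (set_var s x v) (set_reg r x v).
Proof.
move=> [rx rb rm rv ra] x16 vw; split=> //=.
- by move=> y y16; case: eqP => // _; exact: rx.
- by move=> k k9; rewrite ifN ?rb //; lia.
- by move=> y y16; case: eqP => // _; exact: rv.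
Qed.

Lemma represents_set_arr s r k p v : represents s r -> k < 9 -> p < arr_size k ->
  v < 2 ^ w -> represents (set_arr s k p v) (set_mem r (k * n.+2 + p) v).
Proof.
move=> [rx rb rm rv ra] k9 pk vw; split=> //= k' p' k9' pk'.
- case: eqP => [/address_inj[] // -> ->|ne]; first by rewrite eqxx /= eqxx.
  case: (eqVneq k' k) => [ek|_]; last exact: rm.
  by rewrite /=; case: (eqVneq p' p) => [ep|_]; [rewrite ek ep in ne | rewrite rm // ek].
- case: eqP => [ek|_] /=; last exact: ra.
  by case: eqP => // _; apply: ra; rewrite // -ek.
Qed.

(** * Correctness of commands with time bounds *)

Definition yields (c : cmd) (s : store) (T : nat) (Q : store -> Prop) : Prop :=
  forall r, represents s r -> exists t r' s',
    [/\ exec w (compile c) r t r', t <= T, represents s' r' & Q s'].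

Fixpoint wp (c : cmd) (Q : store -> Prop) (s : store) : Prop :=
  match c with
  | Assign x e => safe s e /\ Q (set_var s x (eval s e))
  | Put k i e =>
    [/\ safe s i, eval s i < arr_size k, safe s e &
        Q (set_arr s k (eval s i) (eval s e))]
  | Then a b => wp a (wp b Q) s
  | Cond b c d => cond_safe s b /\ if holds s b then wp c Q s else wp d Q s
  | Loop _ _ => False
  end.

Lemma wp_yields c Q s : cmd_ok c -> wp c Q s -> yields c s (cmd_time c) Q.
Proof.
elim: c Q s => [x e|k i e|a IHa b IHb|b c IHc d IHd|//] Q s /=.
- move=> /andP[x16 oe] [se qs] r rs.
  have [r' [er vr xr mr]] := compile_exprP rs oe se (leqnn 32).
  have rs' : represents s r' by apply: represents_ext rs _ mr.
  have ev := eval_lt rs oe se.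
  do 3!eexists; split; last exact: qs.
  + by apply: ExecSeq; [eassumption | apply: ExecSeq; exact: ExecDo].
  + by rewrite leq_add2l.
  + rewrite /= mod0n addn0 vr modn_small //.
    apply: represents_set_var => //; apply: represents_ext rs' _ _ => // y y32 /=.
    by rewrite ifN //; lia.
- move=> /and3P[k9 oi oe] [si ik se qs] r rs.
  have [r1 [e1 v1 x1 m1]] := compile_exprP rs oi si (leqnn 32).
  have rs1 : represents s r1 by apply: represents_ext rs _ m1.
  pose r2 := set_reg r1 32 (k * n.+2 + eval s i).
  have rs2 : represents s r2.
    by apply: represents_ext rs1 _ _ => // y y32 /=; rewrite ifN //; lia.
  have [r3 [e3 v3 x3 m3]] := compile_exprP rs2 oe se (leqnSn 32).
  have rs3 : represents s r3 by apply: represents_ext rs2 _ m3 => y y32; apply: x3; lia.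
  have ev := eval_lt rs oe se.
  have e2 : exec w (Do (Add 32 32 (16 + k))) r1 1 r2.
    have := ExecDo w (Add 32 32 (16 + k)) r1.
    have [_ rb _ _ _] := rs1.
    by rewrite [exec_instr _ _ _]/= v1 rb // [_ + _ * _]addnC modn_small // address_lt.
  do 3!eexists; split; last exact: qs.
  + by apply: ExecSeq; [apply: ExecSeq; eassumption | apply: ExecSeq; [eassumption | exact: ExecDo]].
  + by [].
  + by rewrite /= v3 x3 //=; exact: represents_set_arr.
- move=> /andP[oa ob] wa r rs.
  have [ta [ra [sa [ea la rsa wb]]]] := IHa _ _ oa wa r rs.
  have [tb [rb [sb [eb lb rsb qb]]]] := IHb _ _ ob wb ra rsa.
  exists (ta + tb), rb, sb; split=> //; [exact: ExecSeq ea eb | exact: leq_add].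
- move=> /and3P[ob oc od] [sb wcd] r rs.
  have [r1 [e1 rs1 b1]] := compile_condP rs ob sb.
  have [t [r' [s' [e' t' rs' q']]]] : exists t r' s',
      [/\ exec w (if holds s b then compile c else compile d) r1 t r',
        t <= maxn (cmd_time c) (cmd_time d), represents s' r' & Q s'].
    case: (holds s b) wcd => [wc|wd].
      have [t [r' [s' [? ? ? ?]]]] := IHc _ _ oc wc r1 rs1.
      by exists t, r', s'; split=> //; rewrite leq_max; apply/orP; left.
    have [t [r' [s' [? ? ? ?]]]] := IHd _ _ od wd r1 rs1.
    by exists t, r', s'; split=> //; rewrite leq_max; apply/orP; right.
  exists (cond_time b + t.+1), r', s'; split=> //; last by lia.
  by apply: ExecSeq e1 _; apply: ExecIf; rewrite b1.
Qed.

Lemma yields_then a b s Ta Tb Qa Q : yields a s Ta Qa ->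
  (forall s', Qa s' -> yields b s' Tb Q) -> yields (Then a b) s (Ta + Tb) Q.
Proof.
move=> ya yb r rs; have [ta [ra [sa [ea la rsa qa]]]] := ya r rs.
have [tb [rb [sb [eb lb rsb qb]]]] := yb _ qa ra rsa.
exists (ta + tb), rb, sb; split=> //; [exact: ExecSeq ea eb | exact: leq_add].
Qed.

Definition loop_time (b : cond) (c : cmd) : nat := cmd_time c + cond_time b + 1.

(** Every round lowers the measure [m], so there are at most [m s] rounds, each taking at most
    [loop_time]. The extra summand in [(m s).+1] pays for the first evaluation of the condition and
    the final test. *)
Lemma yields_loop b c (I : store -> Prop) (m : store -> nat) s :
  cmd_ok (Loop b c) -> (forall s, I s -> cond_safe s b) ->
  (forall s, I s -> holds s b -> wp c (fun s' => I s' /\ m s' < m s) s) ->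
  I s -> yields (Loop b c) s (loop_time b c * (m s).+1) (fun s' => I s' /\ ~~ holds s' b).
Proof.
move=> /andP[ob oc] Ib Ic; suff loop k : forall s r, m s < k -> represents s r -> I s ->
    eval_test (cond_test b) r = holds s b ->
    exists t r' s', [/\ exec w (While (cond_test b) (Seq (compile c) (compile_cond b))) r t r',
      t <= loop_time b c * m s + 1, represents s' r', I s' & ~~ holds s' b].
  move=> Is r rs; have [r1 [e1 rs1 b1]] := compile_condP rs ob (Ib _ Is).
  have [t [r' [s' [e' t' rs' I' b']]]] := loop _ s r1 (ltnSn _) rs1 Is b1.
  exists (cond_time b + t), r', s'; split=> //; first exact: ExecSeq e1 e'.
  have eL : loop_time b c = cmd_time c + cond_time b + 1 by [].
  by rewrite mulnS; lia.
elim: k => // k IH {}s r mk rs Is br; case E: (holds s b); last first.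
  by exists 1, r, s; split=> //; [apply: ExecWhileStop; rewrite br E | lia | rewrite E].
have [t1 [r1 [s1 [e1 l1 rs1 [I1 m1]]]]] := wp_yields oc (Ic _ Is E) rs.
have [r2 [e2 rs2 b2]] := compile_condP rs1 ob (Ib _ I1).
have [|t [r' [s' [e' t' rs' I' b']]]] := IH s1 r2 _ rs2 I1 b2; first by lia.
exists (t1 + cond_time b + t).+1, r', s'; split=> //.
  by apply: ExecWhileStep e'; [rewrite br | exact: ExecSeq e1 e2].
have : loop_time b c * (m s1).+1 <= loop_time b c * m s by rewrite leq_mul2l m1 orbT.
have eL : loop_time b c = cmd_time c + cond_time b + 1 by [].
by rewrite mulnS; lia.
Qed.

End Compilation.

(** * The algorithm *)

(* Variables: 0 number of items, 3 scanned position, 4 and 5 held item and next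
   position of a query, 6 its result, 7 next occurrence, 8 color, 9 argument of
   [skip_from] (its result goes to 5), 10 and 11 held item and next position of
   the simulated schedule, 12 its length, 13 and 14 saved result and position.
   Arrays, all indexed by positions except the last: 0 input, 1 [run_end],
   2 [next_item], 3 [run_count], 4 [match_cost], 5 [meet_cost] (stored at the end
   of the run), 6 [cost 0], 7 schedule, 8 by colors [c]: number of items minus the
   position of the next item of color [c], so that 0 means that there is none. *)
Definition lookup : cmd :=
  let meet := Minus (Plus (Get 5 (Var 7)) (Get 3 (Var 5)))
                    (Plus (Get 3 (Var 7)) (Num 1)) in
  Then (Assign 7 (Get 2 (Var 4)))
  (Cond (Same (Var 7) (Var 5)) (Assign 6 (Get 4 (Var 5)))
  (Cond (Less (Get 6 (Var 5)) meet)
    (Assign 6 (Plus (Get 6 (Var 5)) (Num 1)))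
    (Assign 6 (Plus meet (Num 1))))).

Definition skip_from (e : expr) : cmd :=
  Then (Assign 9 e)
  (Cond (Same (Get 0 (Var 9)) (Var 8))
    (Assign 5 (Get 1 (Var 9)))
    (Assign 5 (Var 9))).

(** Array 8 yields the next occurrence in constant time, as it is read before the current position
    is recorded in it. *)
Definition next_run : cmd :=
  Then (Assign 3 (Minus (Var 3) (Num 1)))
  (Then (Assign 8 (Get 0 (Var 3)))
  (Then (Put 2 (Var 3) (Minus (Var 0) (Get 8 (Var 8))))
  (Then (Put 8 (Var 8) (Minus (Var 0) (Var 3)))
  (Cond (Same (Get 0 (Plus (Var 3) (Num 1))) (Var 8))
    (Then (Put 1 (Var 3) (Get 1 (Plus (Var 3) (Num 1))))
          (Put 3 (Var 3) (Get 3 (Plus (Var 3) (Num 1)))))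
    (Then (Put 1 (Var 3) (Plus (Var 3) (Num 1)))
          (Put 3 (Var 3) (Plus (Get 3 (Plus (Var 3) (Num 1))) (Num 1)))))))).

Definition fill_match : cmd :=
  Then (Assign 4 (Get 1 (Var 3)))
  (Then (skip_from (Plus (Var 4) (Num 1)))
  (Then lookup
  (Put 4 (Var 3) (Plus (Var 6) (Num 1))))).

Definition fill_cost : cmd :=
  Then (Assign 4 (Var 3))
  (Then (Assign 5 (Plus (Var 3) (Num 1)))
  (Then lookup
  (Put 6 (Var 3) (Var 6)))).

(** The cell at the end of a run is overwritten for each item of the run, so the value that remains
    belongs to the first item. *)
Definition fill_meet : cmd :=
  Then (Assign 4 (Var 3))
  (Then (Assign 8 (Get 0 (Get 1 (Var 3))))
  (Then (skip_from (Plus (Var 3) (Num 1)))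
  (Then lookup
  (Cond (Less (Var 6) (Get 4 (Get 1 (Var 3))))
    (Put 5 (Get 1 (Var 3)) (Var 6))
    (Put 5 (Get 1 (Var 3)) (Get 4 (Get 1 (Var 3)))))))).

Definition emit (e : expr) : cmd :=
  Then (Put 7 (Var 12) e) (Assign 12 (Plus (Var 12) (Num 1))).

Definition choose_next : cmd :=
  Then (Assign 8 (Get 0 (Var 10)))
  (Cond (Same (Get 0 (Var 11)) (Var 8))
    (Then (emit (Var 8))
    (Then (Assign 10 (Get 1 (Var 11)))
    (Then (skip_from (Plus (Var 10) (Num 1)))
          (Assign 11 (Var 5)))))
    (Then (Assign 4 (Var 11))
    (Then (skip_from (Plus (Var 11) (Num 1)))
    (Then lookup
    (Then (Assign 13 (Var 6))
    (Then (Assign 14 (Var 5))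
    (Then (Assign 4 (Var 10))
    (Then (Assign 5 (Get 1 (Var 11)))
    (Then lookup
    (Cond (Less (Var 6) (Var 13))
      (Then (emit (Get 0 (Var 11))) (Assign 11 (Get 1 (Var 11))))
      (Then (emit (Var 8))
      (Then (Assign 10 (Var 11)) (Assign 11 (Var 14)))))))))))))).

(** Each lookup made for position [i] has its next position beyond [i], so the entries filled in
    earlier rounds suffice, together with [next_item] at [i]. *)
Definition fill_tables : cmd :=
  Then next_run (Then fill_match (Then fill_cost fill_meet)).

Definition setup : cmd :=
  Then (Assign 3 (Var 0))
  (Then (Put 1 (Var 0) (Var 0))
  (Then (Put 2 (Var 0) (Plus (Var 0) (Num 1)))
        (Put 4 (Var 0) (Num 1)))).

(** After the loop at most the held item is left. [Assign 10 (Var 10)] stands for an empty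
    command. *)
Definition finish : cmd :=
  Then (Cond (Less (Var 10) (Var 0)) (emit (Get 0 (Var 10))) (Assign 10 (Var 10)))
  (Then (Assign 0 (Var 12)) (Assign 2 (Var 12))).

Definition backward : cmd := Loop (Less (Num 0) (Var 3)) fill_tables.
Definition forward : cmd := Loop (Less (Var 11) (Var 0)) choose_next.

Definition restart : cmd :=
  Then (Assign 10 (Num 0)) (Then (Assign 11 (Num 1)) (Assign 12 (Num 0))).

Definition solver : cmd :=
  Then setup (Then backward (Then restart (Then forward finish))).

(** The machine does not multiply, so the base addresses arise by repeatedly adding [n.+2], kept in
    register 32. *)
Fixpoint bases (m : nat) : program :=
  if m is m'.+1 then Seq (bases m') (Do (Add (17 + m') (16 + m') 32))
  else Seq (Do (Const 32 2)) (Seq (Do (Add 32 0 32)) (Do (Const 16 0))).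

(** Register 23 holds the address of array 7, the schedule; it is copied to the output register
    1. *)
Definition sorting_buffer_program : program :=
  Seq (bases 8) (Seq (compile solver) (Seq (Do (Const 32 0)) (Do (Add 1 23 32)))).

Lemma set_arr_ne s k p v k' p' : (k' != k) || (p' != p) ->
  arr (set_arr s k p v) k' p' = arr s k' p'.
Proof.
rewrite /=; case: (eqVneq k' k) => [->|//] /= ne.
by rewrite (negbTE ne).
Qed.

Lemma wp_mono w n C c (Q Q' : store -> Prop) s :
  (forall s', Q s' -> Q' s') -> wp w n C c Q s -> wp w n C c Q' s.
Proof.
elim: c Q Q' s => [x e|k i e|a IHa b IHb|b c IHc d IHd|//] Q Q' s QQ /=.
- by case=> ? /QQ.
- by case=> ? ? ? /QQ.
- by apply: IHa => s'; exact: IHb.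
- by case=> ?; case: ifP => _; [move/(IHc _ _ _ QQ) | move/(IHd _ _ _ QQ)].
Qed.

Lemma wp_then w n C c d Q s :
  wp w n C c (wp w n C d Q) s -> wp w n C (Then c d) Q s.
Proof. by []. Qed.

Ltac split_all :=
  repeat match goal with
  | |- True => exact I
  | |- _ /\ _ => split
  | |- [/\ _, _ & _] => split
  | |- [/\ _, _, _ & _] => split
  end.

(** * The backward scan *)

Section Solver.

Variables (w C : nat) (sigma : seq nat).
Local Notation n := (size sigma).
Local Notation col := (nth 0 sigma).
Hypothesis room : 8 * n.+2 + C.+1 < 2 ^ w.
Hypothesis sigma_pos : all (ltn 0) sigma.
Hypothesis sigma_le : all (geq C) sigma.

Local Notation wp := (wp w n C).

(** The entries from position [j] on are filled. [match_cost] extends to [n.+1], the next occurrence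
    of the sentinel [n]; [meet_cost] is required only at starts of runs. *)
Record tables (j : nat) (a : nat -> nat -> nat) : Prop := Tables {
  tab_col : forall p, a 0 p = col p;
  tab_end : forall p, j <= p <= n -> a 1 p = run_end sigma p;
  tab_next : forall p, j <= p <= n -> a 2 p = next_item sigma p;
  tab_runs : forall p, j <= p <= n -> a 3 p = run_count sigma p;
  tab_match : forall p, j <= p <= n.+1 -> a 4 p = match_cost sigma p;
  tab_meet : forall p, j <= p < n -> col p.-1 != col p ->
    a 5 (run_end sigma p) = meet_cost sigma p;
  tab_cost : forall p, j <= p <= n -> a 6 p = cost sigma 0 p }.

Lemma tables_agree j a a' : tables j a ->
  (forall k p, k < 7 -> j <= p \/ k = 0 -> a' k p = a k p) -> tables j a'.
Proof.
case=> t0 t1 t2 t3 t4 t5 t6 e; split.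
- by move=> p; rewrite e //; right.
- by move=> p jp; rewrite e ?t1 //; lia.
- by move=> p jp; rewrite e ?t2 //; lia.
- by move=> p jp; rewrite e ?t3 //; lia.
- by move=> p jp; rewrite e ?t4 //; lia.
- move=> p jp sp; rewrite e ?t5 //; left.
  by have := run_end_bounds sigma_pos (p := p); lia.
- by move=> p jp; rewrite e ?t6 //; lia.
Qed.

Lemma match_cost_le p : match_cost sigma p <= n.+1.
Proof. by rewrite /match_cost; case: ifP => _ //; exact: cost_le. Qed.

Lemma next_item_leS h : h <= n -> next_item sigma h <= n.+1.
Proof.
move=> hn; case: (ltnP h n) => h'; first by apply: leqW; exact: next_item_le.
by rewrite next_item_id.
Qed.

Lemma query_le h p : h <= n -> query_ok sigma h p -> p <= n.+1.
Proof. by move=> /next_item_leS ?; case/orP=> [/eqP <-//|/and3P[]]; lia. Qed.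

(** By [query_ok] the next position is either the next occurrence, where the cost is [match_cost],
    or one to which [cost_hold] applies; all entries read then lie at positions from [j] on. *)
Lemma wp_lookup j s Q : tables j (arr s) -> j <= var s 5 -> var s 4 <= n ->
  query_ok sigma (var s 4) (var s 5) ->
  arr s 2 (var s 4) = next_item sigma (var s 4) ->
  Q (set_var (set_var s 7 (next_item sigma (var s 4))) 6
       (cost sigma (col (var s 4)) (var s 5))) ->
  wp lookup Q s.
Proof.
move=> T js hn qk en; have jn := next_item_leS hn; have pn := query_le hn qk.
rewrite -en => HQ; split; first by split=> //=; rewrite /arr_size /=; lia.
split=> //=; case: eqP => [ejp|nejp].
  split; first by split=> //; rewrite /arr_size /=; lia.
  move: HQ; rewrite -(_ : arr s 4 (var s 5) = cost sigma (col (var s 4)) (var s 5)) //.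
  by rewrite (tab_match T) ?js // -ejp en match_cost_next.
have [hp pj sp] : [/\ var s 4 < var s 5, var s 5 < next_item sigma (var s 4)
    & col (var s 5).-1 != col (var s 5)].
  by case/orP: qk => [/eqP e|/and3P[]//]; case: nejp; rewrite en.
have [b [pb sb eb rlt cb]] := cost_hold sigma_pos hp pj sp.
have hn' : var s 4 < n by rewrite ltnNge; apply/negP => ?; rewrite next_item_id in pj; lia.
have jn' := next_item_le hn'.
have a5 : arr s 5 (next_item sigma (var s 4)) = meet_cost sigma b.
  by rewrite -eb (tab_meet T) //; lia.
have a3 : arr s 3 (var s 5) = run_count sigma (var s 5) by rewrite (tab_runs T); lia.
have a3' : arr s 3 (next_item sigma (var s 4)) = run_count sigma (next_item sigma (var s 4)).
  by rewrite (tab_runs T); lia.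
have a6 : arr s 6 (var s 5) = cost sigma 0 (var s 5) by rewrite (tab_cost T); lia.
have mb : meet_cost sigma b <= n.+1 by rewrite /meet_cost geq_min match_cost_le.
have rb := run_count_le sigma (var s 5).
have c0 := cost_le sigma_pos 0 (var s 5).
rewrite /arr_size /= !en a5 a3 a3' a6.
have sz : next_item sigma (var s 4) < n.+2 by lia.
have sz' : var s 5 < n.+2 by lia.
split; first by do ![split=> //]; lia.
case: ltnP => cmp; (split; first by do ![split=> //]; lia);
  move: HQ; rewrite cb en; congr (Q (set_var _ _ _)); lia.
Qed.

(** Array 1 is specified up to [n] only. At [n.+1] the color read is 0, so a nonzero variable 8
    makes the test fail there. *)
Lemma wp_skip j s e Q : tables j (arr s) -> safe w n C s e -> eval s e <= n.+1 ->
  j <= eval s e -> (eval s e = n.+1 -> var s 8 != 0) ->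
  Q (set_var (set_var s 9 (eval s e)) 5 (skip_item sigma (var s 8) (eval s e))) ->
  wp (skip_from e) Q s.
Proof.
move=> T se le je c0 HQ; split=> //.
split; first by rewrite /arr_size /=; split=> //; lia.
move: HQ; rewrite /= (tab_col T) /skip_item; case: eqP => [ec|//] HQ.
have le' : eval s e <= n.
  case: (ltnP n (eval s e)) => // gt; have : eval s e = n.+1 by lia.
  by move/c0; rewrite -ec nth_default ?eqxx // ltnW.
split; first by rewrite /arr_size /=; split=> //; lia.
by rewrite (tab_end T) ?je.
Qed.

(** Counting from the end makes zeroed memory the right initial table, so no pass over the colors is
    needed. *)
Definition last_items (j : nat) (a : nat -> nat -> nat) : Prop :=
  forall c, a 8 c = n - (j + index c (drop j sigma)).

Definition scan_state (j : nat) (s : store) : Prop :=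
  [/\ var s 0 = n, var s 3 = j, j <= n, tables j (arr s) & last_items j (arr s)].

Definition item_state (i : nat) (s : store) : Prop :=
  [/\ var s 0 = n, var s 3 = i, i < n, tables i.+1 (arr s) & last_items i (arr s)].

Definition run_state (i : nat) (s : store) : Prop :=
  item_state i s /\ [/\ arr s 1 i = run_end sigma i, arr s 2 i = next_item sigma i &
    arr s 3 i = run_count sigma i].

Lemma wp_next_run j s : scan_state j s -> 0 < j -> 
  wp next_run (fun s' => run_state j.-1 s' /\ var s' 8 = col j.-1) s.
Proof.
case: j => // i [v0 v3 iN T L] _.
have c0 := col_gt0 sigma_pos iN.
have cC : col i <= C by apply: (allP sigma_le); rewrite mem_nth.
have e2 : n - arr s 8 (col i) = next_item sigma i by rewrite L subKn // next_item_le.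
have e1 : arr s 1 i.+1 = run_end sigma i.+1 by rewrite (tab_end T) ?leqnn.
have e3 : arr s 3 i.+1 = run_count sigma i.+1 by rewrite (tab_runs T) ?leqnn.
rewrite /= v0 v3 subn1 addn1 /= !(tab_col T) e2 e1 e3.
pose s' := set_arr (set_arr (set_var (set_var s 3 i) 8 (col i)) 2 i (next_item sigma i))
  8 (col i) (n - i).
have fin : run_state i (set_arr (set_arr s' 1 i (run_end sigma i)) 3 i (run_count sigma i)).
  split; last by split; rewrite /= !eqxx.
  split=> //.
  - apply: tables_agree T _ => k p k7 ip.
    by rewrite /s' !set_arr_ne //; lia.
  - move=> c /=; rewrite (drop_nth 0 iN) /= eq_sym.
    case: eqP => [_|ne]; first by rewrite addn0.
    by rewrite L addnS.
have r8 : arr s 8 (col i) <= n by rewrite L leq_subr.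
have rc := run_count_le sigma i.+1.
rewrite (run_endS iN) (run_countS iN) in fin.
rewrite /arr_size /=; split_all; try lia.
case: eqP fin => _ fin; split_all; rewrite ?addn1 //; lia.
Qed.

Lemma run_state_put i s k v : run_state i s -> 3 < k < 7 -> run_state i (set_arr s k i v).
Proof.
move=> [[v0 v3 iN T L] [e1 e2 e3]] k37; split; last first.
  by split; rewrite set_arr_ne //; lia.
split=> //.
- apply: tables_agree T _ => k' p k7 ip.
  by rewrite set_arr_ne //; lia.
- by move=> c; rewrite set_arr_ne //; lia.
Qed.

Lemma wp_fill_match i s : run_state i s -> var s 8 = col i ->
  wp fill_match (fun s' => run_state i s' /\ arr s' 4 i = match_cost sigma i) s.
Proof.
move=> st v8; have [[v0 v3 iN T L] [e1 e2 e3]] := st.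
have eb := run_end_bounds sigma_pos iN; have ci := col_gt0 sigma_pos iN.
have ne := col_run_end sigma_pos iN.
have rl := skip_item_ge sigma (col i) (run_end sigma i).+1.
apply: wp_then; split; first by rewrite /= v3 /arr_size /=; split=> //; lia.
rewrite [eval _ _]/= v3 e1; apply: wp_then.
apply: (wp_skip (j := i.+1)); rewrite ?[eval _ _]/= ?addn1 //.
- by rewrite /=; split_all; lia.
- lia.
- lia.
- by rewrite /= v8; lia.
rewrite [var _ 8]/= v8; apply: wp_then; apply: (wp_lookup (j := i.+1)) => //.
- by rewrite /=; lia.
- by rewrite /=; lia.
- by rewrite /=; apply: query_skip => //; [lia | rewrite eq_sym].
- by rewrite /= (tab_next T) //; lia.
have cl := cost_le sigma_pos (col (run_end sigma i)) (skip_item sigma (col i) (run_end sigma i).+1).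
rewrite /= v3 /arr_size /=; split_all; try lia.
- exact: run_state_put.
- by rewrite eqxx addn1 /match_cost (ltn_eqF iN) (cost_same sigma_pos iN).
Qed.

Lemma wp_fill_cost i s : run_state i s ->
  wp fill_cost (fun s' => run_state i s' /\
    arr s' 4 i = arr s 4 i /\ arr s' 6 i = cost sigma 0 i) s.
Proof.
move=> st; have [[v0 v3 iN T L] [e1 e2 e3]] := st.
apply: wp_then; split=> //; rewrite [eval _ _]/= v3.
apply: wp_then; split; first by rewrite /= v3; split_all; lia.
rewrite [eval _ _]/= v3 addn1; apply: wp_then; apply: (wp_lookup (j := i.+1)) => //.
- by rewrite /= ltnW.
- by rewrite /=; apply: query_next => //; exact: ltnW.
rewrite /= v3 /arr_size /=; split_all; try lia.
- exact: run_state_put.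
- by rewrite eqxx (cost0 sigma_pos iN).
Qed.

Lemma wp_fill_meet i s : run_state i s -> arr s 4 i = match_cost sigma i ->
  arr s 6 i = cost sigma 0 i -> wp fill_meet (scan_state i) s.
Proof.
move=> st e4 e6; have [[v0 v3 iN T L] [e1 e2 e3]] := st.
have eb := run_end_bounds sigma_pos iN.
have ne := col_run_end sigma_pos iN.
have em : arr s 4 (run_end sigma i) = match_cost sigma (run_end sigma i).
  by rewrite (tab_match T) //; lia.
apply: wp_then; split=> //; rewrite [eval _ _]/= v3.
apply: wp_then; split; first by rewrite /= v3 e1 /arr_size /=; split_all; lia.
rewrite [eval _ _]/= v3 e1 (tab_col T); apply: wp_then.
set c := col (run_end sigma i).
have rl := skip_item_ge sigma c i.+1.
apply: (wp_skip (j := i.+1)); rewrite ?[eval _ _]/= ?v3 ?addn1 //.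
- by rewrite /= v3; split_all; lia.
- exact: ltnW.
- by move=> iN'; lia.
rewrite [var _ 8]/=; apply: wp_then; apply: (wp_lookup (j := i.+1)) => //.
- by rewrite /= ltnW.
- by rewrite /=; apply: query_skip => //; exact: ltnW.
have fin v : v = meet_cost sigma i ->
    scan_state i (set_arr (set_var (set_var (set_var (set_var (set_var (set_var s 4 i) 8 c)
      9 i.+1) 5 (skip_item sigma c i.+1)) 7 (next_item sigma i)) 6
      (cost sigma (col i) (skip_item sigma c i.+1))) 5 (run_end sigma i) v).
  move=> ->; split=> //; first exact: ltnW.
  split.
  - by move=> p; rewrite set_arr_ne // (tab_col T).
  - move=> p jp; rewrite set_arr_ne //=.
    by case: (eqVneq p i) => [->//|pi]; rewrite (tab_end T) //; lia.
  - move=> p jp; rewrite set_arr_ne //=.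
    by case: (eqVneq p i) => [->//|pi]; rewrite (tab_next T) //; lia.
  - move=> p jp; rewrite set_arr_ne //=.
    by case: (eqVneq p i) => [->//|pi]; rewrite (tab_runs T) //; lia.
  - move=> p jp; rewrite set_arr_ne //=.
    by case: (eqVneq p i) => [->//|pi]; rewrite (tab_match T) //; lia.
  - move=> p jp sp; case: (eqVneq p i) => [->|pi]; first by rewrite /= eqxx.
    rewrite set_arr_ne ?(tab_meet T) //; first by lia.
    (* If the runs of [p] and [i] had the same end, [p.-1] and [p] would both lie in the run of [i],
       so [p] would not start a run. *)
    apply/orP; right; apply/eqP => er; case/negP: sp; apply/eqP.
    have ? := run_end_bounds sigma_pos (p := p).
    by rewrite (col_in_run sigma_pos (p := i) (q := p.-1)) 1?(col_in_run sigma_pos (p := i) (q := p)) //; lia.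
  - move=> p jp; rewrite set_arr_ne //=.
    by case: (eqVneq p i) => [->//|pi]; rewrite (tab_cost T) //; lia.
rewrite /= v3 e1 em /arr_size /=; split_all; try lia.
by case: ltnP => cmp; split_all; try lia;
  apply: fin; rewrite /meet_cost -/c; lia.
Qed.

Lemma wp_fill_tables j s : scan_state j s -> 0 < j ->
  wp fill_tables (fun s' => scan_state j.-1 s') s.
Proof.
move=> st j0; apply: wp_then; apply: wp_mono (wp_next_run st j0) => s1 [st1 v8].
apply: wp_then; apply: wp_mono (wp_fill_match st1 v8) => s2 [st2 e4].
apply: wp_then; apply: wp_mono (wp_fill_cost st2) => s3 [st3 [e4' e6]].
by apply: wp_fill_meet; rewrite // e4'.
Qed.

(** * The forward scan *)

(** List form of the configuration with item [h] held and [p] next; the sentinel [h = n] means that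
    all is processed. *)
Definition items (h p : nat) : seq nat := if h < n then col h :: drop p sigma else [::].

Lemma opt_items h p : h < n -> opt 0 0 (items h p) = cost sigma (col h) p.
Proof. by move=> hn; rewrite /items hn /= (gtn_eqF (col_gt0 sigma_pos hn)). Qed.

Lemma items_match h p : h < n -> p < n -> col h = col p ->
  choose_items (col h) (items h p) =
    items (run_end sigma p) (skip_item sigma (col h) (run_end sigma p).+1) /\
  opt 0 0 (items h p) = (opt 0 0 (choose_items (col h) (items h p))).+1.
Proof.
move=> hn pn ec; have c0 := col_gt0 sigma_pos hn.
have -> : items h p = [:: col h, col h & drop p.+1 sigma].
  by rewrite /items hn (drop_nth 0 pn) ec.
split; last by rewrite opt_double ?drop_pos.
rewrite /= eqxx skip_itemE // ec -run_endE // /items.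
case: ltnP => en; last by rewrite drop_oversize.
by rewrite (drop_nth 0 en) skip_itemE // -ec.
Qed.

Lemma items_other h p : h < n -> p < n -> col h != col p ->
  choose_items (col h) (items h p) = items p (skip_item sigma (col h) p.+1) /\
  choose_items (col p) (items h p) = items h (run_end sigma p).
Proof.
move=> hn pn ec; rewrite /items hn pn (drop_nth 0 pn) /= !eqxx.
rewrite [col p == _]eq_sym (negbTE ec) !skip_itemE ?col_gt0 //.
by rewrite -run_endE.
Qed.

(** The colors emitted so far lead to the simulated configuration, and their number plus the
    remaining optimum stays within the total optimum. The bound on variable 12 keeps writes inside
    array 7. *)
Definition plan_state (s : store) : Prop :=
  let h := var s 10 in let p := var s 11 in
  [/\ var s 0 = n /\ tables 0 (arr s), h <= n, h < p <= n.+1 /\ var s 12 < p,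
    query_ok sigma h p &
    foldl (choose_color 2) (initial_config 2 sigma) (mkseq (arr s 7) (var s 12)) =
      initial_config 2 (items h p) /\
    var s 12 + opt 0 0 (items h p) <= opt 0 0 sigma].

Lemma mkseq_put s m v :
  mkseq (arr (set_arr s 7 m v) 7) m.+1 = rcons (mkseq (arr s 7) m) v.
Proof.
rewrite /mkseq -[m.+1]addn1 iotaD map_cat cats1 /= eqxx; congr rcons.
apply/eq_in_map => x; rewrite mem_iota add0n => /andP[_ xm] /=.
by rewrite (ltn_eqF xm).
Qed.

Lemma plan_step s s' v : plan_state s ->
  var s' 0 = n -> arr s' = arr (set_arr s 7 (var s 12) v) ->
  var s' 12 = (var s 12).+1 -> var s 11 < var s' 11 <= n.+1 ->
  var s' 10 < var s' 11 -> var s' 10 <= n -> query_ok sigma (var s' 10) (var s' 11) ->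
  choose_items v (items (var s 10) (var s 11)) = items (var s' 10) (var s' 11) ->
  opt 0 0 (items (var s' 10) (var s' 11)) < opt 0 0 (items (var s 10) (var s 11)) ->
  plan_state s'.
Proof.
move=> [[v0 T] hn [hp lp] qk [fl op]] v0' ea el pp hp' hn' qk' ec eo.
split=> //; [split=> // | split; lia | split; last lia].
  by rewrite ea; apply: tables_agree T _ => k p k7 ip; rewrite set_arr_ne //; lia.
by rewrite el ea mkseq_put foldl_rcons fl choose_color_items ec.
Qed.

Lemma wp_choose_next s : plan_state s -> var s 11 < n ->
  wp choose_next (fun s' => plan_state s' /\ n.+1 - var s' 11 < n.+1 - var s 11) s.
Proof.
move=> st pn; have [[v0 T] hn [hp lp] qk [fl op]] := st.
move eh: (var s 10) st hn hp qk fl op => h st hn hp qk fl op.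
move ep: (var s 11) pn st hp lp qk fl op => p pn st hp lp qk fl op.
have hn' : h < n by lia.
have c0 := col_gt0 sigma_pos hn'.
have eb := run_end_bounds sigma_pos pn.
have e1 : arr s 1 p = run_end sigma p by rewrite (tab_end T) //; lia.
apply: wp_then; split; first by rewrite /= eh /arr_size /=; split_all; lia.
rewrite [eval _ _]/= eh (tab_col T).
split; first by rewrite /= ep /arr_size /=; split_all; lia.
rewrite [holds _ _]/= ep (tab_col T) eq_sym; case: eqP => [ec|/eqP ec].
  apply: wp_then; split=> //; first by rewrite /= /arr_size /=; lia.
  split; first by rewrite /=; split_all; lia.
  rewrite ![eval _ _]/= addn1.
  apply: wp_then; split; first by rewrite /= ep /arr_size /=; split_all; lia.
  rewrite [eval _ _]/= ep e1; apply: wp_then.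
  have rl := skip_item_ge sigma (col h) (run_end sigma p).+1.
  apply: (wp_skip (j := 0)) => //.
  - apply: tables_agree T _ => k q k7 ip; rewrite set_arr_ne //; lia.
  - by rewrite /=; split_all; lia.
  - by rewrite /= addn1; lia.
  - by rewrite /= -lt0n.
  rewrite [eval _ _]/= addn1 [var _ 8]/=; split=> //.
  have [ci oi] := items_match hn' pn ec.
  have qk' : query_ok sigma (run_end sigma p) (skip_item sigma (col h) (run_end sigma p).+1).
    by apply: query_skip => //; [lia | rewrite ec eq_sym col_run_end].
  have ql : skip_item sigma (col h) (run_end sigma p).+1 <= n.+1.
    by apply: query_le qk'; lia.
  split; last by rewrite /=; lia.
  apply: (plan_step (v := col h) st) => //=; rewrite ?ep ?eh; try lia.
  - exact: ci.
  - by rewrite oi ci.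
have [cu cz] := items_other hn' pn ec.
(* The two lookups evaluate the two terms, so the cheaper choice lowers the remaining optimum by
   exactly one. *)
have opair : opt 0 0 (items h p) =
    (minn (cost sigma (col p) (skip_item sigma (col h) p.+1))
          (cost sigma (col h) (run_end sigma p))).+1.
  by rewrite opt_items // cost_diff.
have rl := skip_item_ge sigma (col h) p.+1.
have qk1 : query_ok sigma p (skip_item sigma (col h) p.+1).
  by apply: query_skip => //; exact: ltnW.
have ql1 : skip_item sigma (col h) p.+1 <= n.+1 by apply: query_le qk1; exact: ltnW.
have qk2 : query_ok sigma h (run_end sigma p) by exact: query_run_end.
apply: wp_then; split=> //; rewrite [eval _ _]/= ep; apply: wp_then.
apply: (wp_skip (j := 0)) => //.
- by rewrite /= ep; split_all; lia.
- by rewrite /= ep addn1; lia.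
- by move=> _; rewrite /= -lt0n.
rewrite [eval _ _]/= ep addn1 [var _ 8]/=; apply: wp_then.
apply: (wp_lookup (j := 0)) => //; first exact: ltnW.
  by rewrite /= (tab_next T) //; lia.
do 2![apply: wp_then; split=> //].
apply: wp_then; split=> //; rewrite ![eval _ _]/= eh.
apply: wp_then; split; first by rewrite /= ep /arr_size /=; split_all; lia.
rewrite [eval _ _]/= ep e1; apply: wp_then.
apply: (wp_lookup (j := 0)) => //.
  by rewrite /= (tab_next T) //; lia.
split=> //=; case: ltnP => cmp.
  rewrite ep /arr_size /= (tab_col T) addn1 e1; split_all; try lia.
  by apply: (plan_step (v := col p) st) => //=; rewrite ?ep ?eh //; try lia;
    rewrite opair opt_items //; lia.
rewrite /arr_size /= addn1 ep; split_all; try lia.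
by apply: (plan_step (v := col h) st) => //=; rewrite ?ep ?eh //; try lia;
  rewrite opair opt_items //; lia.
Qed.

(** * The whole program *)

Definition input_store : store :=
  Store (reg (input_state C sigma)) (fun k p => if k == 0 then col p else 0).

(** The sentinel entries of arrays 1, 2 and 4 are written; zeroed memory already provides the
    others. *)
Lemma wp_setup : wp setup (scan_state n) input_store.
Proof.
apply: wp_then; split=> //; apply: wp_then; split=> //.
apply: wp_then; split=> //; first by rewrite /=; split_all; lia.
split=> //.
have dn : drop n sigma = [::] by rewrite drop_size.
split=> //; last by move=> c; rewrite dn /=; lia.
split=> //.
- move=> p; rewrite -eqn_leq => /eqP <-; rewrite /= eqxx run_end_id //.
- move=> p; rewrite -eqn_leq => /eqP <-; rewrite /= eqxx addn1 next_item_id //.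
- by move=> p; rewrite -eqn_leq => /eqP <-; rewrite /run_count dn.
- move=> p np /=; rewrite /match_cost; case: eqP => // ne.
  by rewrite cost_nil ?nth_default //; lia.
- by move=> p; lia.
- by move=> p; rewrite -eqn_leq => /eqP <-; rewrite cost_nil.
Qed.

Lemma wp_restart s : scan_state 0 s -> wp restart plan_state s.
Proof.
move=> [v0 v3 n0 T L]; split=> //; split=> //; split=> //.
have it : items 0 1 = sigma by rewrite /items; case: sigma => //= x s'; rewrite drop0.
split=> //=; first exact: query_next.
by rewrite it.
Qed.

Definition solved (s : store) : Prop :=
  let sched := mkseq (arr s 7) (var s 2) in
  [/\ var s 0 = var s 2, feasible 2 sigma sched & var s 2 <= opt 0 0 sigma].

Lemma wp_finish s : plan_state s -> n <= var s 11 -> wp finish solved s.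
Proof.
move=> [[v0 T] hn [hp lp] qk [fl op]] pn.
apply: wp_then; split=> //; rewrite [holds _ _]/= v0; case: ltnP => hn'; last first.
  split=> //; split=> //; split=> //; rewrite /solved /=; split=> //.
    by rewrite /feasible fl /items ltnNge hn'.
  by move: op; rewrite /items ltnNge hn'; lia.
apply: wp_then; split=> //; [by rewrite /= /arr_size /=; lia | by rewrite /= /arr_size /=; split=> //; lia |].
split; first by rewrite /=; split_all; lia.
split=> //; split=> //; rewrite /solved; split=> //.
  rewrite /feasible [var _ 2]/= addn1 mkseq_put foldl_rcons fl choose_color_items.
  by rewrite /items hn' drop_oversize //= (tab_col T) eqxx.
move: op; rewrite opt_items // cost_nil // (gtn_eqF (col_gt0 sigma_pos hn')) /=; lia.
Qed.

Definition solver_time : nat :=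
  cmd_time setup + (loop_time (Less (Num 0) (Var 3)) fill_tables * n.+1 +
  (cmd_time restart + (loop_time (Less (Var 11) (Var 0)) choose_next * n.+1 +
   cmd_time finish))).

Lemma solver_yields : yields w n C solver input_store solver_time solved.
Proof.
apply: yields_then; first exact: (wp_yields room (c := setup) isT wp_setup).
move=> s1 st1.
have back : yields w n C backward s1 (loop_time (Less (Num 0) (Var 3)) fill_tables * n.+1)
    (scan_state 0).
  have := yields_loop room (b := Less (Num 0) (Var 3)) (c := fill_tables)
    (I := fun s => scan_state (var s 3) s) (m := fun s => var s 3) (s := s1) isT.
  have [_ e3 _ _ _] := st1; rewrite e3 => H r rs.
  have [|||t [r' [s' [ex lt rs' [I' b']]]]] := H _ _ _ r rs => //.
  - move=> s I0 hs; have pos : 0 < var s 3 := hs; apply: wp_mono (wp_fill_tables I0 pos) => s' st'.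
    by have [_ e _ _ _] := st'; rewrite e; split=> //; lia.
  - exists t, r', s'; split=> //; move: I' b'; rewrite /=.
    by case: (var s' 3).
apply: yields_then; first exact: back.
move=> s2 st2; apply: yields_then.
  exact: (wp_yields room (c := restart) isT (wp_restart st2)).
move=> s3 st3.
have fwd : yields w n C forward s3 (loop_time (Less (Var 11) (Var 0)) choose_next * n.+1)
    (fun s => plan_state s /\ n <= var s 11).
  have H := yields_loop room (b := Less (Var 11) (Var 0)) (c := choose_next)
    (I := plan_state) (m := fun s => n.+1 - var s 11) (s := s3) isT.
  move=> r rs; have [|||t [r' [s' [ex lt rs' [I' b']]]]] := H _ _ _ r rs => //.
  - move=> s I0; have [[v0 _] _ _ _ _] := I0; rewrite [holds _ _]/= v0.
    exact: wp_choose_next.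
  - exists t, r', s'; split=> //.
      apply: leq_trans lt _; rewrite leq_mul2l; apply/orP; right.
      by have [_ _ [? _] _ _] := st3; lia.
    by split=> //; have [[v0 _] _ _ _ _] := I'; rewrite /= v0 -leqNgt in b'.
apply: yields_then; first exact: fwd.
move=> s4 [st4 pn].
exact: (wp_yields room (c := finish) isT (wp_finish st4 pn)).
Qed.

Lemma exec_bases m r : m <= 8 -> reg r 0 = n -> exists r',
  [/\ exec w (bases m) r (m + 3) r', mem r' = mem r,
      forall x, x < 16 -> reg r' x = reg r x, reg r' 32 = n.+2 &
      forall k, k <= m -> reg r' (16 + k) = k * n.+2].
Proof.
move=> + r0; elim: m => [_|m IH m8].
  eexists; split.
  - by apply: (ExecSeq (t := 1) (t' := 2)); [|apply: (ExecSeq (t := 1) (t' := 1))]; exact: ExecDo.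
  - by [].
  - by move=> x x16 /=; rewrite !ifN //; lia.
  - by rewrite /= r0 [2 %% _]modn_small ?modn_small ?addn2 //; lia.
  - by move=> k; rewrite leqn0 => /eqP -> /=; rewrite mod0n.
have [r' [ex em ex16 e32 eb]] := IH (ltnW m8).
eexists; split.
- have -> : m.+1 + 3 = m + 3 + 1 by lia.
  by apply: ExecSeq ex _; exact: ExecDo.
- by rewrite /= em.
- by move=> x x16 /=; rewrite ifN ?ex16 //; lia.
- by rewrite /= ifN //; lia.
- move=> k km; rewrite [reg _ _]/=; case: (eqVneq k m.+1) => [->|kn].
    rewrite addnS addSn eqxx eb // e32 modn_small ?mulSnr //.
    have : m.+1 * n.+2 <= 8 * n.+2 by rewrite leq_mul2r; lia.
    by rewrite mulSnr; lia.
  by rewrite ifN ?eb //; lia.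
Qed.

Lemma program_correct : exists t r,
  [/\ exec w sorting_buffer_program (input_state C sigma) t r,
      t <= 13 + solver_time, optimal_schedule 2 sigma (output_schedule r) &
      output_cost r = color_changes (output_schedule r)].
Proof.
have [r1 [e1 em1 x1 e32 eb]] := exec_bases (leqnn 8) (erefl : reg (input_state C sigma) 0 = n).
have nw : n < 2 ^ w by lia.
have rs1 : represents w n C input_store r1.
  split=> //.
  - move=> k p k9 pk; rewrite em1 /= ; case: eqP => [-> //|k0].
    (* Arrays other than the input start beyond its last cell, where memory is zero. *)
    rewrite nth_default //; case: k k0 {k9 pk} => // k _.
    by rewrite mulSn; lia.
  - by case=> [|[|x]] //= _; [lia | rewrite nth_nil expn_gt0].
  - move=> k p k9 pk /=; case: eqP => _; last by rewrite expn_gt0.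
    case: (ltnP p n) => pn; last by rewrite nth_default ?expn_gt0.
    have : col p <= C by apply: (allP sigma_le); rewrite mem_nth.
    by lia.
have [t [r2 [s2 [e2 t2 rs2 [v0 fs os]]]]] := solver_yields rs1.
have [rx rb rm rv ra] := rs2.
set r := exec_instr w (Add 1 23 32) (exec_instr w (Const 32 0) r2).
have out : output_schedule r = mkseq (arr s2 7) (var s2 2).
  have os_le := leq_trans os (opt_size 0 0 sigma); rewrite addn0 in os_le.
  rewrite /output_schedule [reg r 2]/= [reg r 1]/= mod0n addn0.
  rewrite (rx 2 isT) (rb 7 isT : reg r2 23 = _) modn_small; last by lia.
  rewrite -[7 * n.+2]addn0 iotaDl -map_comp; apply/eq_in_map => x.
  rewrite mem_iota add0n => /andP[_ xl] /=.
  by rewrite rm // /arr_size /=; lia.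
have [opt_s len_s] := optimal_of_size sigma_pos fs ltac:(by rewrite size_mkseq).
exists (8 + 3 + (t + (1 + 1))), r; split.
- apply: ExecSeq e1 _; apply: ExecSeq e2 _.
  by apply: ExecSeq; exact: ExecDo.
- by lia.
- by rewrite out.
- by rewrite out -len_s size_mkseq -v0 /output_cost /= rx.
Qed.

End Solver.

Theorem theorem4 :
  exists (P : program) (d K : nat),
    forall (C w : nat) (sigma : seq nat),
      all (fun c => 0 < c <= C) sigma ->
      up_log 2 (size sigma + C) + d <= w ->
      exists (t : nat) (s : state),
        [/\ exec w P (input_state C sigma) t s,
            t <= K * nlogC (size sigma) C,
            optimal_schedule 2 sigma (output_schedule s) &
            output_cost s = color_changes (output_schedule s)].
Proof.
(* At the empty sequence [solver_time] is the sum of the coefficients of the linear bound; 13 counts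
   11 steps for the base addresses and 2 for the output address. *)
pose K0 := 13 + solver_time [::].
(* Six extra bits give a factor 64, enough for [8 * n.+2 + C.+1] with [n] items. The factor 2 comes
   from [n.+1 <= 2 * nlogC n C]. *)
exists sorting_buffer_program, 6, (2 * K0) => C w sigma sigmaC ww.
have pos : all (ltn 0) sigma by apply: sub_all sigmaC => c /andP[].
have leC : all (geq C) sigma by apply: sub_all sigmaC => c /andP[].
have room : 8 * (size sigma).+2 + C.+1 < 2 ^ w.
  have up : size sigma + C <= 2 ^ up_log 2 (size sigma + C) by exact: up_logP.
  have u0 : 0 < 2 ^ up_log 2 (size sigma + C) by rewrite expn_gt0.
  have : 2 ^ (up_log 2 (size sigma + C) + 6) <= 2 ^ w by rewrite leq_exp2l.
  by rewrite expnD; have -> : 2 ^ 6 = 64 by []; lia.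
have [t [r [ex tt os oc]]] := program_correct room pos leC.
exists t, r; split=> //; apply: leq_trans tt _.
apply: (@leq_trans (K0 * (size sigma).+1)).
  rewrite /K0 /solver_time /= !muln1.
  move: (cmd_time setup) (cmd_time restart) (cmd_time finish) => a b c.
  move: (loop_time _ _) (loop_time _ _) => l1 l2; nia.
rewrite [2 * K0]mulnC -mulnA leq_mul2l; apply/orP; right.
have : size sigma <= size sigma * maxn 1 (up_log 2 C).
  by rewrite -{1}[size sigma]muln1 leq_mul2l leq_maxl orbT.
rewrite /nlogC; lia.
Qed.
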